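(* Let $\Gamma$ be a finite, compact, connected metric tree and let $f$ be an arbitrary (real-valued, not identically zero) eigenfunction of the standard (Kirchhoff) Laplacian $-\Delta_\Gamma$ corresponding to its first positive eigenvalue $\mu_2(\Gamma)$. Then all global minima and maxima of $f$ are located at the boundary of $\Gamma$; that is, every point $x \in \Gamma$ with $f(x) = \max_\Gamma f$ or $f(x) = \min_\Gamma f$ is a vertex of degree one.
   Context: A finite, compact metric graph $\Gamma$ consists of a finite vertex set $V$ and a finite edge set $E$, where each edge $e \in E$ is identified with a compact interval $[0,\ell_e]$ of finite length $\ell_e>0$ whose endpoints are identified with vertices; $\Gamma$ is regarded as a compact metric space with the shortest-path distance. It is a tree if it contains no cycles; it is understood to have at least one edge. The degree of a vertex is the number of edges incident to it. The boundary of a tree $\Gamma$ is the set of its vertices of degree one. The standard (or Kirchhoff) Laplacian $-\Delta_\Gamma$ is the self-adjoint operator in $L^2(\Gamma) = \bigoplus_{e\in E} L^2(0,\ell_e)$ acting as $f \mapsto -f''$ on each edge, with domain consisting of all $f$ whose restriction to each edge $e$ lies in the Sobolev space $H^2(0,\ell_e)$ and which satisfy the standard (continuity-Kirchhoff) conditions at each vertex $v$: $f$ is continuous at $v$, and the sum over all edge ends at $v$ of the derivatives of $f$ at $v$, taken in the direction pointing into $v$, is zero (at a vertex of degree one this is the Neumann condition). Its spectrum is discrete, and its eigenvalues, counted with multiplicity, are $0=\mu_1(\Gamma)\le \mu_2(\Gamma)\le\ldots$. If $\Gamma$ is connected then $\mu_2(\Gamma)>0$, so $\mu_2(\Gamma)$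 is the first positive eigenvalue. *)

(* Defs.v *)
From HB Require Import structures.
From mathcomp Require Import all_boot all_order all_algebra.
From mathcomp Require Import all_classical all_reals all_analysis.
Set Implicit Arguments.
Unset Strict Implicit.
Unset Printing Implicit Defensive.
Import Order.TTheory GRing.Theory Num.Theory.
Import numFieldNormedType.Exports.
Local Open Scope classical_set_scope.
Local Open Scope ring_scope.

(** * Finite compact metric graphs *)

(* The edge [e] is the interval [0, len e], glued to the vertex [src e] at 0
   and to the vertex [tgt e] at [len e].  The orientation is only a
   parametrization; loops and multiple edges are allowed. *)
Record metric_graph (R : realType) := MetricGraph {
  vertex : finType;
  edge : finType;
  src : edge -> vertex;
  tgt : edge -> vertex;
  len : edge -> R;
  len_gt0 : forall e, 0 < len e }.

Section Combinatorics.
Context {R : realType} (G : metric_graph R).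

Definition adjacent : rel (vertex G) := fun v w =>
  [exists e : edge G, ((src e == v) && (tgt e == w)) ||
                      ((src e == w) && (tgt e == v))].

Definition connected_graph : Prop :=
  forall v w : vertex G, connect adjacent v w.

(* An edge with a direction of traversal; [true] is from [src] to [tgt]. *)
Definition dart : Type := (edge G * bool)%type.
Definition dart_tail (d : dart) : vertex G := if d.2 then src d.1 else tgt d.1.
Definition dart_head (d : dart) : vertex G := if d.2 then tgt d.1 else src d.1.

(* Distinctness of the edges excludes going back and forth along one edge;
   loops and pairs of parallel edges are cycles. *)
Definition is_cycle (c : seq dart) : bool :=
  [&& c != [::],
      path.cycle (fun d d' => dart_head d == dart_tail d') c,
      uniq [seq dart_tail d | d <- c] &
      uniq [seq d.1 | d <- c]].

Definition is_tree : Prop :=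
  connected_graph /\ forall c : seq dart, ~~ is_cycle c.

Definition degree (v : vertex G) : nat :=
  #|[pred e : edge G | (src e == v) || (tgt e == v)]|.

(* The points of the metric graph: the vertices and, disjointly, the points of
   the open edges. *)
Definition graph_point : Type :=
  (vertex G + {e : edge G & {t : R | 0 < t < len e}})%type.

Definition vertex_point (v : vertex G) : graph_point := inl v.

(* The point with arc-length coordinate [t] on the edge [e], for
   [0 <= t <= len e]; values of [t] beyond an endpoint give that endpoint. *)
Definition edge_point (e : edge G) (t : R) : graph_point :=
  if (insub t : option {s : R | 0 < s < len e}) is Some s
  then inr (existT _ e s)
  else inl (if t <= 0 then src e else tgt e).

Definition on_edge (f : graph_point -> R) (e : edge G) : R -> R :=
  fun t => f (edge_point e t).

End Combinatorics.

(** * The Sobolev space [H^2(0, l)] *)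

Section Sobolev.
Context {R : realType}.
Local Notation mu := (@lebesgue_measure R).

Definition in_L2 (l : R) (u : R -> R) : Prop :=
  u \_ `]0, l[ \in Lfun mu 2%:E.

Definition test_function (l : R) (phi : R -> R) : Prop :=
  (forall (n : nat) (x : R), derivable (derive1n n phi) x 1) /\
  exists a b : R, [/\ 0 < a, b < l &
    forall x, phi x != 0 -> a <= x <= b].

Definition weak_derivative (l : R) (u v : R -> R) : Prop :=
  forall phi, test_function l phi ->
    (\int[mu]_(x in `]0, l[) (u x * derive1 phi x))%R =
    - (\int[mu]_(x in `]0, l[) (v x * phi x))%R.

(* [u] is in H^2(0, l), with second weak derivative [w]. *)
Definition H2_second_derivative (l : R) (u w : R -> R) : Prop :=
  [/\ in_L2 l u, in_L2 l w &
    exists v, [/\ in_L2 l v, weak_derivative l u v & weak_derivative l v w]].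

Definition in_H2 (l : R) (u : R -> R) : Prop :=
  exists w, H2_second_derivative l u w.

(* One-sided derivatives; the limits exist for the continuous representative
   of a function in H^2, at the endpoints of the interval. *)
Definition right_derivative (u : R -> R) (a : R) : R :=
  lim ((fun h => h^-1 * (u (a + h) - u a)) @ 0^'+).
Definition left_derivative (u : R -> R) (a : R) : R :=
  lim ((fun h => h^-1 * (u (a + h) - u a)) @ 0^'-).

End Sobolev.

(** * The standard (Kirchhoff) Laplacian *)

Section Laplacian.
Context {R : realType} (G : metric_graph R).
Local Notation mu := (@lebesgue_measure R).

(* A class in L^2 with H^2 edge components, continuous at the vertices, is
   identified with its unique representative that is a continuous function on
   the metric graph.  As [f] takes a single value at each vertex, continuity at
   the vertices is continuity on the closed edges. *)
Definition graph_continuous (f : graph_point G -> R) : Prop :=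
  forall e : edge G, {within `[0, len e], continuous (on_edge f e)}.

(* Derivatives are taken in the direction pointing into [v]. *)
Definition kirchhoff (f : graph_point G -> R) (v : vertex G) : Prop :=
  \sum_(e : edge G | src e == v) (- right_derivative (on_edge f e) 0) +
  \sum_(e : edge G | tgt e == v) left_derivative (on_edge f e) (len e) = 0.

Definition laplacian_domain (f : graph_point G -> R) : Prop :=
  [/\ graph_continuous f,
      forall e : edge G, in_H2 (len e) (on_edge f e) &
      forall v : vertex G, kirchhoff f v].

(* [f] is in the domain and [- Delta f = g] in L^2. *)
Definition laplacian (f g : graph_point G -> R) : Prop :=
  laplacian_domain f /\
  forall e : edge G, exists2 w : R -> R,
    H2_second_derivative (len e) (on_edge f e) w &
    {ae mu, forall t, 0 < t < len e -> on_edge g e t = - w t}.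

Definition eigenfunction (lambda : R) (f : graph_point G -> R) : Prop :=
  (exists x, f x != 0) /\ laplacian f (fun x => lambda * f x).

Definition eigenvalue_of_laplacian (lambda : R) : Prop :=
  exists f : graph_point G -> R, eigenfunction lambda f.

Definition first_positive_eigenvalue (lambda : R) : Prop :=
  [/\ 0 < lambda, eigenvalue_of_laplacian lambda &
    forall nu, 0 < nu -> eigenvalue_of_laplacian nu -> lambda <= nu].

End Laplacian.

Arguments connected_graph {R} G.
Arguments is_tree {R} G.
Arguments first_positive_eigenvalue {R} G lambda.

(* Main.v *)
(** Suppose that a point [x] other than a leaf is an extremum. Then all
    derivatives of [f] at [x] vanish, and [f x] is not zero, since otherwise
    [f] would vanish identically. It remains to find a positive eigenvalue
    below [K ^ 2 = mu2], and for this no variational principle is needed. For a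
    directed edge [d] of the tree, solutions of [f'' + k^2 f = 0] on the branch
    entered through [d] that satisfy the vertex conditions beyond the tail of
    [d] have a Pruefer angle [A d k] at that tail, which increases with [k] from
    [A d 0 = 0]. Let [p d] be the frequency at which it reaches [pi / 2], the
    first eigenfrequency of the branch with a Dirichlet condition at the tail;
    it is strictly smaller than [p d'] for the edges [d'] that follow [d]. A
    solution of frequency [K] with derivative zero and nonzero value at the tail
    of [d] forces [p d < K], so the extremum yields two edges with [p < K] at a
    common vertex, or a point inside an edge at which the angles of the two
    branches are too large. Following the edges with the smallest [p], one
    reaches either a vertex where the two smallest values of [p] coincide,
    or an edge on which the angles of the two branches add up to [pi] at some
    [k < K]; in both cases the branch solutions fit together to an
    eigenfunction of eigenvalue [k ^ 2 < mu2].

    That the weak eigenfunctions are sines and cosines on the edges is seen by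
    testing against the compactly supported solutions [phi] of
    [phi'' + k^2 phi = psi], where [psi] is a combination of three bump
    functions orthogonal to [cos (k x)] and [sin (k x)]. *)

Require Import Defs.
From mathcomp Require Import all_boot all_order all_algebra.
From mathcomp Require Import all_classical all_reals all_analysis.
From mathcomp Require Import ring lra.
Import Order.TTheory GRing.Theory Num.Theory.
Import numFieldNormedType.Exports.
Local Open Scope classical_set_scope.
Local Open Scope ring_scope.

Set Implicit Arguments.
Unset Strict Implicit.
Unset Printing Implicit Defensive.

(** * Walks in a tree *)

Section Walks.
Context {R : realType} {G : metric_graph R}.
Implicit Types (d : dart G) (p : seq (dart G)).

Definition flip d : dart G := (d.1, ~~ d.2).

(** A step of a non-backtracking walk; iterated from [d], it sweeps out the branch entered through
    [d]. *)
Definition onward : rel (dart G) :=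
  fun d d' => (dart_tail d' == dart_head d) && (d' != flip d).

Lemma flipK : involutive flip.
Proof. by case=> e b; rewrite /flip /= negbK. Qed.

Lemma flip_inj : injective flip. Proof. exact: inv_inj flipK. Qed.

Lemma flip_neq d : flip d != d.
Proof. by case: d => e b; rewrite xpair_eqE eqxx; case: b. Qed.

Lemma tail_flip d : dart_tail (flip d) = dart_head d.
Proof. by case: d => e []. Qed.

Lemma head_flip d : dart_head (flip d) = dart_tail d.
Proof. by case: d => e []. Qed.

Lemma eq_edge d d' : d.1 = d'.1 -> d' = d \/ d' = flip d.
Proof.
by case: d d' => e b [e' b'] /= ->; case: b b' => [] []; [left|right|right|left].
Qed.

Lemma onward_flip d d' : onward (flip d') (flip d) = onward d d'.
Proof.
by rewrite /onward tail_flip head_flip flipK eq_sym (eq_sym (flip d)).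
Qed.

Definition visited d p := rcons [seq dart_tail d' | d' <- d :: p]
  (dart_head (last d p)).

Context (acyclic : forall c : seq (dart G), ~~ is_cycle c).

(** An edge used twice must occur in both directions, as [a] and [flip a]. Since the tails are
    distinct, each of the two follows the other cyclically; at most one of these turns is the
    closing one, and [onward] forbids the other. *)
Lemma closed_walk_cycle d p : path onward d p ->
  dart_head (last d p) = dart_tail d -> uniq [seq dart_tail d' | d' <- d :: p] ->
  is_cycle (d :: p).
Proof.
move=> walk closed tails.
set E := fun d d' : dart G => dart_head d == dart_tail d'.
have cyc : path.cycle E (d :: p).
  rewrite /= rcons_path; apply/andP; split; last by rewrite /E closed.
  by apply: sub_path walk => a b /andP[]; rewrite /E eq_sym.
apply/and4P; split => //.
have ud : uniq (d :: p) by apply: map_uniq tails.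
rewrite map_inj_in_uniq // => a b ain bin eab.
have [|ba] := eq_edge eab; first by [].
exfalso.
have tailI x y : x \in d :: p -> y \in d :: p -> dart_tail x = dart_tail y -> x = y.
  move=> xin yin exy; have /eqP := exy.
  rewrite -(nth_index d xin) -(nth_index d yin).
  rewrite -!(nth_map d (dart_tail d)) ?index_mem //.
  by rewrite nth_uniq ?size_map ?index_mem // => /eqP ->.
have nextE x y : x \in d :: p -> y \in d :: p -> dart_tail y = dart_head x ->
    next (d :: p) x = y.
  move=> xin yin yx; apply: tailI => //; first by rewrite mem_next.
  by have /eqP <- := next_cycle cyc xin; rewrite yx.
have ab : next (d :: p) a = b by apply: nextE; rewrite // ba tail_flip.
have ba' : next (d :: p) b = a by apply: nextE; rewrite // ba head_flip.
have aNb : a != b by rewrite ba eq_sym flip_neq.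
have st x y : x \in d :: p -> y = next (d :: p) x -> x != y ->
    x = last d p \/ onward x y.
  move=> xin -> _; have [i ii ->] : exists2 i, (i < size (d :: p))%N & x = nth d (d :: p) i.
    by exists (index x (d :: p)); rewrite ?index_mem // nth_index.
  rewrite next_nth mem_nth // index_uniq //.
  have [ilt|ige] := ltnP i (size p).
    by right; have /(pathP d) := walk; apply.
  left; rewrite (last_nth d).
  by have /eqP -> : i == size p by rewrite eqn_leq ige andbT -ltnS.
have [al|/andP[_]] := st a b ain (esym ab) aNb; last by rewrite ba eqxx.
have bNa : b != a by rewrite eq_sym.
have [bl|/andP[_]] := st b a bin (esym ba') bNa; last by rewrite ba flipK eqxx.
by rewrite al bl eqxx in aNb.
Qed.

Lemma visited_uniq d p : path onward d p -> uniq (visited d p).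
Proof.
elim: p d => [|d1 p IH] d /=.
  move=> _; rewrite !andbT inE; apply/negP => /eqP loop.
  have /negP := acyclic [:: d]; apply.
  by apply: closed_walk_cycle.
move=> /andP[dd1 walk]; apply/andP; split; last exact: IH.
rewrite -[_ :: _]/(visited d1 p); apply/negP => din.
pose q := d1 :: p.
have [i ilt iP] : exists2 i, (i <= size p)%N & dart_head (nth d q i) = dart_tail d.
  move: din; rewrite mem_rcons in_cons => /orP[/eqP ->|].
    by exists (size p); rewrite // (last_nth d).
  move=> /(nthP (dart_tail d)) [i]; rewrite size_map => ilt; rewrite (nth_map d) //.
  case: i ilt => [_ /= e|i ilt <-].
    have /negP := acyclic [:: d]; case.
    apply: closed_walk_cycle => //=; have /andP[/eqP <- _] := dd1.
    exact: e.
  exists i; first by apply: ltnW.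
  by have /(pathP d) /(_ _ ilt) /andP[/eqP <- _] := walk.
have walk' : path onward d (take i.+1 q).
  by apply: take_path; rewrite /= dd1.
have uq : uniq [seq dart_tail d' | d' <- d1 :: p].
  by move: (IH _ walk); rewrite /visited rcons_uniq => /andP[].
pose P := [pred j | (j <= size p)%N && (dart_head (nth d q j) == dart_tail d)].
have exP : exists j, P j by exists i; rewrite /= ilt iP eqxx.
(* The earliest return to the tail of [d], so that the closed walk cut off there has distinct
   tails. *)
case: (ex_minnP exP) => j /andP[jlt /eqP jP] jmin.
have /negP := acyclic (d :: take j.+1 q); apply; apply: closed_walk_cycle.
- by apply: take_path; rewrite /= dd1.
- have sz : size (take j.+1 q) = j.+1 by rewrite size_take /= ltnS; case: ltngtP jlt => // ->.
  have -> : last d (take j.+1 q) = nth d q j by rewrite (last_nth d) sz -[LHS]/(nth d (take j.+1 q) j) nth_take.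
  exact: jP.
rewrite map_cons cons_uniq map_take take_uniq // andbT.
apply/negP => /(nthP (dart_tail d)) [m].
rewrite size_take size_map => mlt.
have ms : (m < j.+1)%N by move: mlt; case: (ltnP j.+1) => // h lt_m; exact: leq_trans lt_m h.
have msq : (m < size q)%N by apply: (leq_trans ms).
rewrite nth_take // (nth_map d) //.
case: m {mlt} ms msq => [_ _ e|m ms msq e].
  have /negP := acyclic [:: d]; case.
  apply: closed_walk_cycle => //=; have /andP[/eqP <- _] := dd1.
  exact: e.
have mp : (m < size p)%N := msq.
have mP : P m.
  rewrite /P /= ltnW //=.
  by have /(pathP d) /(_ _ mp) /andP[/eqP <- _] := walk; rewrite e.
by have := jmin m mP; rewrite leqNgt -ltnS ms.
Qed.

Lemma walk_size d p : path onward d p -> (size p < #|vertex G|)%N.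
Proof.
move=> /visited_uniq /card_uniqP; rewrite size_rcons size_map /= => e.
apply: leq_trans (max_card (mem (visited d p))).
by rewrite e.
Qed.

(** Walks repeat no vertex, so their lengths are bounded and [onward] is well-founded. *)
Lemma onward_ind (P : dart G -> Prop) :
  (forall d, (forall d', onward d d' -> P d') -> P d) -> forall d, P d.
Proof.
move=> step d.
have H n : forall d, (forall p, path onward d p -> (size p < n)%N) -> P d.
  elim: n => [|n IH] d0 H; first by have := H [::] isT.
  apply: step => d' dd'; apply: IH => p walk.
  by rewrite -ltnS; apply: (H (d' :: p)); rewrite /= dd'.
by apply: (H #|vertex G|) => p; apply: walk_size.
Qed.

(** [Phi d] looks only at the successors of [d], so the iterates at [d] are stable once their number
    exceeds the size of every walk continuing [d]; the number of vertices suffices. *)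
Lemma onward_rec (T : Type) (x0 : T) (Phi : dart G -> (dart G -> T) -> T) :
  (forall d f g, (forall d', onward d d' -> f d' = g d') -> Phi d f = Phi d g) ->
  exists f, forall d, f d = Phi d f.
Proof.
move=> ext; pose it n := iter n (fun f d => Phi d f) (fun=> x0).
have H n : forall d, (forall p, path onward d p -> (size p < n)%N) ->
    it n d = it n.+1 d.
  elim: n => [|n IH] d0 H; first by have := H [::] isT.
  rewrite -[LHS]/(Phi d0 (it n)) -[RHS]/(Phi d0 (it n.+1)); apply: ext => d' dd'; apply: IH => p walk.
  by rewrite -ltnS; apply: (H (d' :: p)); rewrite /= dd'.
exists (it #|vertex G|) => d; rewrite [LHS]H // => p; exact: walk_size.
Qed.

End Walks.

(** * Angles and thresholds of the branches *)

Section Angles.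
Context {R : realType} {G : metric_graph R}.
Implicit Types (d : dart G) (k : R).

Lemma continuous_IVT (f : R -> R) (a b v : R) : a <= b ->
  (forall x, a <= x <= b -> {for x, continuous f}) ->
  f a <= v <= f b -> exists2 c, a <= c <= b & f c = v.
Proof.
move=> ab cf /andP[fa fb].
have fab : f a <= f b by apply: le_trans fb.
have [c cab <-] : exists2 c, c \in `[a, b] & f c = v.
  apply: IVT => //; last by rewrite min_l // max_r // fa fb.
  by apply: continuous_in_subspaceT => x; rewrite inE /= in_itv /=; exact: cf.
by exists c => //; move: cab; rewrite in_itv.
Qed.

(** For such [k >= 0] the angles of the branches after [d] stay in [[0, pi / 2)], where the tangent
    is finite and increasing. *)
Definition below (p : dart G -> R) d k := forall d', onward d d' -> k < p d'.

(** The vertex condition at the head adds up the scaled derivatives of the following branches, hence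
    their tangents. At a leaf the empty sum gives the angle 0 of the Neumann condition. *)
Definition head_angle (A : dart G -> R -> R) d k :=
  atan (\sum_(d' | onward d d') tan (A d' k)).

(* On a solution that satisfies the vertex conditions beyond [d], the value and
   the scaled derivative at the tail of [d] are proportional to the cosine and
   the sine of [A d k]. *)
Definition branch_angle (A : dart G -> R -> R) :=
  forall d k, A d k = k * len d.1 + head_angle A d k.

(** The data carried by the induction along [onward]. The third clause makes thresholds strictly
    increase along a walk; the fourth makes the angle grow at least at the rate of the edge
    length. *)
Definition threshold_at (A : dart G -> R -> R) (p : dart G -> R) d :=
  [/\ 0 < p d, A d (p d) = pi / 2, below p d (p d),
      forall k1 k2, 0 <= k1 -> k1 <= k2 -> k2 <= p d ->
        A d k1 + (k2 - k1) * len d.1 <= A d k2 &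
      forall k, 0 <= k <= p d -> {for k, continuous (A d)}].

Section Step.
Context (A : dart G -> R -> R) (p : dart G -> R).
Context (angleE : branch_angle A).
Context (angle0 : forall d, A d 0 = 0).

Lemma angle_itv d k : threshold_at A p d -> 0 <= k -> k < p d ->
  0 <= A d k < pi / 2.
Proof.
case=> p0 Ap _ mono _ k0 kp.
have l0 := len_gt0 (d.1).
have := mono 0 k (lexx _) k0 (ltW kp); rewrite angle0 add0r subr0 => /(le_trans _) -> /=; last first.
  by rewrite mulr_ge0 // ltW.
rewrite -Ap; apply: lt_le_trans (mono k (p d) k0 (ltW kp) (lexx _)).
by rewrite ltrDl mulr_gt0 // subr_gt0.
Qed.

Lemma angle_itv_tan d k : threshold_at A p d -> 0 <= k -> k < p d ->
  A d k \in `](- (pi / 2)), (pi / 2)[.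
Proof.
move=> h k0 kp; have /andP[A0 A1] := angle_itv h k0 kp.
by rewrite in_itv /= A1 andbT (lt_le_trans _ A0) // oppr_lt0 divr_gt0 // pi_gt0.
Qed.

Lemma tan_angle_ge0 d k : threshold_at A p d -> 0 <= k -> k < p d ->
  0 <= tan (A d k).
Proof.
move=> h k0 kp; have /andP[A0 A1] := angle_itv h k0 kp.
rewrite /tan divr_ge0 //; last by apply/cos_ge0_pihalf; rewrite (ltW A1) andbT (le_trans _ A0) // oppr_le0 divr_ge0 // pi_ge0.
apply: sin_ge0_pi; rewrite A0 (le_trans (ltW A1)) // ler_pdivrMr //.
by rewrite ler_peMr ?pi_ge0 // ler1n.
Qed.

Section Follow.
Context (d : dart G).
Context (follow : forall d', onward d d' -> threshold_at A p d').

Lemma head_angle_mono k1 k2 : 0 <= k1 -> k1 <= k2 -> below p d k2 ->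
  head_angle A d k1 <= head_angle A d k2.
Proof.
move=> k0 k12 bel; apply: le_atan; apply: ler_sum => d' dd'.
have h := follow dd'; have k2p := bel _ dd'.
have k1p := le_lt_trans k12 k2p; have k20 := le_trans k0 k12.
rewrite leNgt ltr_tan ?angle_itv_tan // -leNgt.
case: h => _ _ _ /(_ k1 k2 k0 k12 (ltW k2p)) h _; apply: le_trans h.
by rewrite lerDl mulr_ge0 ?subr_ge0 // ltW // len_gt0.
Qed.

Lemma head_angle_ge k d' : 0 <= k -> below p d k -> onward d d' ->
  A d' k <= head_angle A d k.
Proof.
move=> k0 bel dd'.
rewrite -[leLHS]tanK; last by apply: angle_itv_tan; [exact: follow| |exact: bel].
apply: le_atan; rewrite (bigD1 d') //= lerDl; apply: sumr_ge0 => o /andP[od _].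
by apply: tan_angle_ge0 => //; [exact: follow|exact: bel].
Qed.

Lemma head_angle_itv k : 0 <= k -> below p d k -> 0 <= head_angle A d k < pi / 2.
Proof.
move=> k0 bel; rewrite /head_angle atan_ltpi2 andbT -[leLHS](@atan0 R).
apply: le_atan; apply: sumr_ge0 => o od.
by apply: tan_angle_ge0 => //; [exact: follow|exact: bel].
Qed.

Lemma head_angle_continuous k : 0 <= k -> below p d k ->
  {for k, continuous (head_angle A d)}.
Proof.
move=> k0 bel.
apply: (@continuous_comp _ _ _ (fun k => \sum_(d' | onward d d') tan (A d' k))); last exact: continuous_atan.
apply: cvg_big => [x|d' dd'].
  by apply: cvgD; [exact: cvg_fst|exact: cvg_snd].
have h := follow dd'; have kp := bel _ dd'.
apply: continuous_comp.
  by case: h => _ _ _ _; apply; rewrite k0 ltW.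
apply: continuous_tan; apply/lt0r_neq0/cos_gt0_pihalf.
by have := angle_itv_tan h k0 kp; rewrite in_itv.
Qed.

Lemma angle_continuous k : 0 <= k -> below p d k -> {for k, continuous (A d)}.
Proof.
move=> k0 bel.
have -> : A d = (fun k => k * len d.1 + head_angle A d k) by apply/funext.
apply: cvgD; last exact: head_angle_continuous.
by apply: cvgM; [exact: cvg_id|exact: cvg_cst].
Qed.

Lemma angle_mono k1 k2 : 0 <= k1 -> k1 <= k2 -> below p d k2 ->
  A d k1 + (k2 - k1) * len d.1 <= A d k2.
Proof.
move=> k0 k12 bel; rewrite !angleE; have := head_angle_mono k0 k12 bel.
by rewrite mulrBl; lra.
Qed.

End Follow.

Lemma near_threshold d k0 eps : threshold_at A p d -> 0 <= k0 -> k0 < p d ->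
  0 < eps -> exists k1, [/\ k0 <= k1, k1 < p d & pi / 2 - eps <= A d k1].
Proof.
move=> h k00 k0p eps0.
have /andP[_ A1] := angle_itv h k00 k0p.
case: h => p0 Ap _ mono cont.
pose v := Num.max (A d k0) (pi / 2 - eps).
have vlt : v < pi / 2 by rewrite /v gt_max A1 ltrBlDr ltrDl eps0.
have [|||k1 /andP[k01 k1p] k1v] := @continuous_IVT (A d) k0 (p d) v.
- exact: ltW.
- by move=> k /andP[a b]; apply: cont; rewrite (le_trans k00).
- by rewrite Ap (ltW vlt) andbT le_max lexx.
exists k1; split => //; last by rewrite k1v le_max lexx orbT.
by rewrite lt_neqAle k1p andbT; apply: contraTneq vlt => e; rewrite -k1v e Ap ltxx.
Qed.

(** As [k] approaches the least threshold [p m] after [d], the head angle approaches [pi / 2], and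
    the extra [k * len d.1] carries [A d k] to [pi / 2] before [p m] is reached. *)
Lemma threshold_exists d : (forall d', onward d d' -> threshold_at A p d') ->
  exists k, [/\ 0 < k, A d k = pi / 2 & below p d k].
Proof.
move=> follow; have l0 := len_gt0 (d.1).
have pi0 : 0 < pi / 2 :> R by rewrite divr_gt0 // pi_gt0.
suff [k1 [k10 bel Ak1]] : exists k1, [/\ 0 <= k1, below p d k1 & pi / 2 <= A d k1].
  have belk k : k <= k1 -> below p d k.
    by move=> kk1 d' dd'; apply: le_lt_trans (bel _ dd').
  have [|||c /andP[c0 c1] cv] := @continuous_IVT (A d) 0 k1 (pi / 2) => //.
  - by move=> x /andP[x0 xk]; apply: angle_continuous => //; exact: belk.
  - by rewrite angle0 (ltW pi0).
  exists c; split => //; last exact: belk.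
  by rewrite lt_neqAle c0 andbT; apply: contraTneq pi0 => e; rewrite -cv -e angle0 ltxx.
have [[a od]|none] := pselect (exists o, onward d o); last first.
  exists (pi / 2 / len d.1); split.
  - by rewrite ltW // divr_gt0.
  - by move=> d' dd'; case: none; exists d'.
  - rewrite angleE divfK ?gt_eqF // /head_angle big1 ?atan0 ?addr0 // => d' dd'.
    by case: none; exists d'.
case: (@arg_minP _ _ _ _ (onward d) p od) => m dm mmin.
have hm := follow _ dm; have m0 : 0 < p m by case: hm.
(* Starting from [p m / 2] makes [k1 * len d.1] at least the tolerance allowed for [A m k1]. *)
have [|||k1 [k01 k1p k1A]] := @near_threshold m (p m / 2) (p m / 2 * len d.1) hm.
- by rewrite ltW // divr_gt0.
- by rewrite ltr_pdivrMr // ltr_pMr // ltr1n.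
- by rewrite mulr_gt0 // divr_gt0.
have bel : below p d k1 by move=> d' /mmin; exact: lt_le_trans.
have k10 : 0 <= k1 by apply: le_trans k01; rewrite ltW // divr_gt0.
exists k1; split => //.
rewrite angleE; have := head_angle_ge follow k10 bel dm.
have : p m / 2 * len d.1 <= k1 * len d.1 by rewrite ler_pM2r.
by lra.
Qed.

End Step.

Lemma thresholds_exist (acyclic : forall c : seq (dart G), ~~ is_cycle c) :
  exists A p, [/\ branch_angle A, forall d, A d 0 = 0 & forall d, threshold_at A p d].
Proof.
have [A angleE] : exists A, branch_angle A.
  have [d f g fg|A AE] := @onward_rec R G acyclic (R -> R) (fun=> 0)
      (fun d f k => k * len d.1 + head_angle f d k).
    by apply/funext => k; congr (_ + atan _); apply: eq_bigr => d' /fg ->.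
  by exists A => d k; rewrite AE.
have angle0 d : A d 0 = 0.
  elim/(onward_ind acyclic): d => d IH; rewrite angleE mul0r add0r /head_angle.
  by rewrite big1 ?atan0 // => d' /IH ->; rewrite tan0.
(* Each [p d] is picked by [xget], given the thresholds of its successors; the default 0 is excluded
   afterwards by [threshold_exists]. *)
have [d f g fg|p pE] := @onward_rec R G acyclic R 0
    (fun d f => xget 0 [set k | [/\ 0 < k, A d k = pi / 2 & below f d k]]).
  congr (xget 0 _); apply/seteqP.
  by split=> k [k0 Ak bel]; split => // d' dd'; have := bel _ dd'; rewrite fg.
exists A, p; split => // d; elim/(onward_ind acyclic): d => d IH.
have [k kP] := threshold_exists angleE angle0 IH.
have [p0 Ap bel] : [/\ 0 < p d, A d (p d) = pi / 2 & below p d (p d)].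
  by rewrite pE; case: xgetP => // /(_ k).
have belk k' : k' <= p d -> below p d k'.
  by move=> kk1 d' dd'; apply: le_lt_trans (bel _ dd').
split => // [k1 k2 k10 k12 k2p|k' /andP[k0 k'p]].
  by apply: (angle_mono angleE angle0 IH) => //; exact: belk.
by apply: (angle_continuous angleE angle0 IH) => //; exact: belk.
Qed.

End Angles.

(** * Modes *)

(* [F] gives the values at the vertices; on the edge of [d], at distance [s]
   from the tail of [d], the function is
   [F (dart_tail d) * cos (k * s) + beta d * sin (k * s)]. *)
Definition mode {R : realType} {G : metric_graph R} (k : R)
    (F : vertex G -> R) (beta : dart G -> R) : Prop :=
  [/\ forall d, F (dart_head d) =
        F (dart_tail d) * cos (k * len d.1) + beta d * sin (k * len d.1),
      forall d, beta (flip d) =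
        F (dart_tail d) * sin (k * len d.1) - beta d * cos (k * len d.1) &
      forall v, \sum_(d | dart_tail d == v) beta d = 0].

Definition nontrivial_mode {R : realType} (G : metric_graph R) (k : R) : Prop :=
  exists (F : vertex G -> R) (beta : dart G -> R),
    mode k F beta /\ exists d, F (dart_tail d) != 0 \/ beta d != 0.

Section Modes.
Context {R : realType} {G : metric_graph R}.
Context (acyclic : forall c : seq (dart G), ~~ is_cycle c).
Context (A : dart G -> R -> R) (p : dart G -> R).
Context (angleE : branch_angle A) (angle0 : forall d, A d 0 = 0).
Context (thr : forall d, threshold_at A p d).
Implicit Types (d : dart G).
Local Notation theta := (head_angle A).

Lemma below_onward d d' k : below p d k -> onward d d' -> below p d' k.
Proof.
move=> bel dd' e d'e; apply: lt_trans (bel _ dd') _.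
by have [_ _ + _ _] := thr d'; apply.
Qed.

Lemma below_threshold d k : k <= p d -> below p d k.
Proof.
by move=> kp d' dd'; apply: le_lt_trans kp _; have [_ _ + _ _] := thr d; apply.
Qed.

Lemma onwardE d e : onward (flip d) e = (dart_tail e == dart_tail d) && (e != d).
Proof. by rewrite /onward head_flip flipK. Qed.

Lemma sum_tail d (g : dart G -> R) :
  \sum_(e | dart_tail e == dart_tail d) g e = g d + \sum_(e | onward (flip d) e) g e.
Proof. by rewrite (bigD1 d) //=; congr (_ + _); apply: eq_bigl => e; rewrite onwardE. Qed.

Lemma cos_angle_gt0 d k : 0 <= k -> k < p d -> 0 < cos (A d k).
Proof.
move=> k0 kp; apply/cos_gt0_pihalf.
by have := angle_itv_tan angle0 (thr d) k0 kp; rewrite in_itv.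
Qed.

Lemma cos_head_angle_gt0 d k : 0 < cos (theta d k).
Proof. by apply/cos_gt0_pihalf; rewrite atan_gtNpi2 atan_ltpi2. Qed.

Lemma sin_head_angle d k :
  sin (theta d k) = cos (theta d k) * \sum_(e | onward d e) tan (A e k).
Proof.
rewrite -[X in _ * X]atanK -/(theta d k) /tan mulrC divfK //.
exact/lt0r_neq0/cos_head_angle_gt0.
Qed.

(** Induction from the leaves: on each following branch [beta] is the vertex value times the tangent
    of the angle, the vertex condition sums these to the tangent of the head angle, and crossing the
    edge adds [k * len d.1] to the angle. *)
Lemma mode_branch k F beta d : mode k F beta -> 0 <= k -> below p d k ->
  exists c, F (dart_tail d) = c * cos (A d k) /\ beta d = c * sin (A d k).
Proof.
move=> modeF k0; have [hd fl sm] := modeF.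
elim/(onward_ind acyclic): d => d IH bel.
have betaE d' : onward d d' -> beta d' = F (dart_head d) * tan (A d' k).
  move=> dd'; have [c [cF cb]] := IH _ dd' (below_onward bel dd').
  have /andP[/eqP <- _] := dd'.
  rewrite cF cb /tan -mulrA [cos _ * _]mulrC divfK //.
  exact/lt0r_neq0/cos_angle_gt0/bel.
have cn0 := lt0r_neq0 (cos_head_angle_gt0 d k).
(* The amplitude is read off at the head, where the cosine is positive; [cos (A d k)] may vanish. *)
pose c := F (dart_head d) / cos (theta d k).
have Fc : F (dart_head d) = c * cos (theta d k) by rewrite divfK.
have flc : beta (flip d) = - (c * sin (theta d k)).
  have := sm (dart_tail (flip d)); rewrite sum_tail flipK (eq_bigr _ betaE) -mulr_sumr.
  by rewrite sin_head_angle mulrA -Fc => /eqP; rewrite addr_eq0 => /eqP.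
exists c; have := hd (flip d); have := fl (flip d).
rewrite flipK head_flip tail_flip /= Fc flc => -> ->.
by rewrite angleE -/(theta d k) cosD sinD; split; ring.
Qed.

(** At distance [s] the value and the scaled derivative are an amplitude times the cosine and the
    sine of the angle in the conclusion. This angle is positive, and its sine vanishes because the
    amplitude does not. *)
Lemma critical_angle k F beta d s : mode k F beta -> 0 < k ->
  0 <= s < len d.1 -> below p d k ->
  F (dart_tail d) * cos (k * s) + beta d * sin (k * s) != 0 ->
  beta d * cos (k * s) = F (dart_tail d) * sin (k * s) ->
  pi <= theta d k + k * (len d.1 - s).
Proof.
move=> modeF k0 /andP[s0 sl] bel val der; rewrite leNgt; apply/negP => ltpi.
have [c [cF cb]] := mode_branch modeF (ltW k0) bel.
set x := theta d k + _ in ltpi.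
have xE : A d k - k * s = x by rewrite angleE /x; ring.
have x0 : 0 < x.
  rewrite /x ltr_wpDl //; last by rewrite mulr_gt0 // subr_gt0.
  by case/andP: (head_angle_itv angle0 (fun d' _ => thr d') (ltW k0) bel).
have sx : 0 < sin x by rewrite sin_gt0_pi // x0.
have : c * sin x = 0.
  rewrite -xE sinB; apply/eqP; rewrite mulrBr subr_eq0; apply/eqP.
  by rewrite !mulrA -cF -cb der.
move=> /eqP; rewrite mulf_eq0 (gt_eqF sx) orbF => /eqP c0.
by move: val; rewrite cF cb c0 !mul0r addr0 eqxx.
Qed.

(** For [k <= p d] the angle in [critical_angle] is at most [A d k <= pi / 2], short of [pi]. *)
Lemma critical_threshold k F beta d s : mode k F beta -> 0 < k ->
  0 <= s < len d.1 ->
  F (dart_tail d) * cos (k * s) + beta d * sin (k * s) != 0 ->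
  beta d * cos (k * s) = F (dart_tail d) * sin (k * s) ->
  p d < k.
Proof.
move=> modeF k0 sl val der; rewrite ltNge; apply/negP => kp.
have := critical_angle modeF k0 sl (below_threshold kp) val der.
have [p0 Ap _ mono _] := thr d; have /andP[s0 _] := sl.
have l0 := len_gt0 d.1.
have := mono k (p d) (ltW k0) kp (lexx _); rewrite Ap angleE -/(theta d k).
have : 0 <= (p d - k) * len d.1 by rewrite mulr_ge0 ?subr_ge0 // ltW.
have : 0 <= k * s by rewrite mulr_ge0 // ltW.
have := @pi_gt0 R; rewrite mulrBr; lra.
Qed.

(** * Gluing branch solutions around a root vertex *)

Section Root.
Context (r : vertex G).

Definition away d := exists d0 q,
  [/\ path onward d0 q, dart_tail d0 = r & last d0 q = d].

Lemma away_onward d d' : away d -> onward d d' -> away d'.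
Proof.
move=> [d0 [q [walk d0r lq]]] dd'; exists d0, (rcons q d'); split => //.
  by rewrite rcons_path walk lq.
by rewrite last_rcons.
Qed.

Lemma away_head d : away d -> dart_head d != r.
Proof.
move=> [d0 [q [walk d0r lq]]].
have := visited_uniq acyclic walk; rewrite /visited lq rcons_uniq => /andP[+ _].
by apply: contraNneq => ->; rewrite -d0r inE eqxx.
Qed.

Context (k F0 : R) (c : dart G -> R).
Context (k_ge0 : 0 <= k).
Context (root_below : forall d, dart_tail d = r -> below p d k).
Context (root_value : forall d, dart_tail d = r -> c d * cos (A d k) = F0).
Context (root_sum : \sum_(d | dart_tail d == r) c d * sin (A d k) = 0).

Lemma away_below d : away d -> below p d k.
Proof.
move=> [d0 [q [walk d0r <-]]]; have := root_below d0r.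
elim: q d0 walk {d0r} => [|d1 q IH] d0 //= /andP[d01 walk] b0.
by apply: IH => //; apply: below_onward b0 d01.
Qed.

(* A dart pointing towards the root has amplitude zero, so no choice of a
   parent is needed. *)
Lemma amplitudes : exists amp : dart G -> R, forall d, amp d =
  if dart_tail d == r then c d
  else (\sum_(d0 | onward d0 d) amp d0 * cos (theta d0 k)) / cos (A d k).
Proof.
(* Amplitudes spread outwards from the root, whereas [onward_rec] computes a value from successors;
   hence the recursion over reversed darts. *)
have [d f g fg|f fE] := @onward_rec R G acyclic R 0
    (fun e g => if dart_head e == r then c (flip e) else
      (\sum_(e' | onward e e') g e' * cos (theta (flip e') k)) / cos (A (flip e) k)).
  by case: ifP => // _; congr (_ / _); apply: eq_bigr => e /fg ->.
exists (fun d => f (flip d)) => d; rewrite fE head_flip flipK; case: ifP => // _.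
congr (_ / _); rewrite (reindex_inj (@flip_inj R G)) /=.
by apply: eq_big => [e|e _]; [rewrite onward_flip|rewrite flipK].
Qed.

(** Amplitudes are passed outwards so as to keep the function continuous; beyond the root the vertex
    conditions are then built into the head angles. At the root, continuity and the vertex condition
    are [root_value] and [root_sum]. *)
Lemma root_mode : exists F beta, [/\ mode k F beta, F r = F0 &
  forall d, dart_tail d = r -> beta d = c d * sin (A d k)].
Proof.
have [amp ampE] := amplitudes.
have amp_away d : amp d != 0 -> away d.
  rewrite -(flipK d); move: (flip d) => e; elim/(onward_ind acyclic): e => e IH.
  rewrite ampE tail_flip; case: (dart_head e =P r) => [er _|_].
    by exists (flip e), [::]; rewrite /= tail_flip.
  rewrite mulf_eq0 negb_or => /andP[nz _].
  have [a /andP[ae na]] : exists a, onward a (flip e) && (amp a != 0).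
    apply: contrapT => none; case/eqP: nz; apply: big1 => a ae.
    have [->|na] := eqVneq (amp a) 0; first by rewrite mul0r.
    by case: none; exists a; rewrite ae.
  have ea : onward e (flip a) by rewrite -onward_flip flipK.
  by apply: away_onward ae; rewrite -(flipK a); apply: IH => //; rewrite flipK.
have amp0 d : dart_head d = r -> amp d = 0.
  by move=> dr; apply: contrapT => /eqP /amp_away /away_head; rewrite dr eqxx.
(* A nonzero incoming amplitude comes from a dart pointing away from the root, so [k < p d] and the
   cosine is positive; otherwise both sides are 0. *)
have ampcos d : dart_tail d != r -> amp d * cos (A d k) =
    \sum_(d0 | onward d0 d) amp d0 * cos (theta d0 k).
  move=> dr; rewrite ampE (negbTE dr).
  have [[a /andP[ad na]]|none] := pselect (exists a, onward a d && (amp a != 0)).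
    rewrite divfK //; apply/lt0r_neq0/cos_angle_gt0 => //.
    exact: (away_below (amp_away _ na)).
  rewrite big1 ?mul0r // => a ad.
  have [->|na] := eqVneq (amp a) 0; first by rewrite mul0r.
  by case: none; exists a; rewrite ad.
have amptan d : dart_tail d != r -> amp d * sin (A d k) =
    \sum_(d0 | onward d0 d) amp d0 * cos (theta d0 k) * tan (A d k).
  move=> dr; have [e|nz] := eqVneq (cos (A d k)) 0.
    rewrite big1 => [|a _]; last by rewrite /tan e invr0 !mulr0.
    by rewrite ampE (negbTE dr) e invr0 mulr0 mul0r.
  by rewrite -mulr_suml -ampcos // /tan -mulrA; congr (_ * _); rewrite mulrC divfK.
pose F v := if v == r then F0 else
  \sum_(d | dart_head d == v) amp d * cos (theta d k).
pose beta d := amp d * sin (A d k) - amp (flip d) * sin (theta (flip d) k).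
have FE d : F (dart_tail d) = amp d * cos (A d k) + amp (flip d) * cos (theta (flip d) k).
  rewrite /F; case: eqP => [dr|/eqP dr].
    by rewrite (amp0 (flip d)) ?head_flip // mul0r addr0 ampE dr eqxx root_value.
  rewrite (bigD1 (flip d)) ?head_flip //= addrC ampcos //; congr (_ + _).
  apply: eq_bigl => e; rewrite /onward eq_sym; congr andb.
  by rewrite -(inj_eq (@flip_inj R G)) flipK eq_sym.
exists F, beta; split; last first.
- move=> d dr; rewrite /beta ampE dr eqxx (amp0 (flip d)) ?head_flip //.
  by rewrite mul0r subr0.
- by rewrite /F eqxx.
split=> [d|d|v].
- rewrite -[LHS]/(F (dart_head d)) -tail_flip !FE flipK /beta.
  (* Multiplying by [cos ^ 2 + sin ^ 2 = 1] makes the identity polynomial, within reach of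
     [ring]. *)
  rewrite -[X in _ + X = _]mulr1 -(cos2Dsin2 (k * len d.1)).
  by rewrite !angleE /= -!/(theta _ _) !cosD !sinD; ring.
- rewrite FE /beta flipK.
  rewrite -[X in _ - X = _]mulr1 -(cos2Dsin2 (k * len d.1)).
  by rewrite !angleE /= -!/(theta _ _) !cosD !sinD; ring.
have -> : \sum_(d | dart_tail d == v) beta d =
    \sum_(d | dart_tail d == v) amp d * sin (A d k) -
    \sum_(d | dart_head d == v) amp d * sin (theta d k).
  rewrite /beta big_split sumrN; congr (_ - _).
  rewrite [RHS](reindex_inj (@flip_inj R G)) /=.
  by apply: eq_bigl => d; rewrite head_flip.
have [->|vr] := eqVneq v r.
  rewrite [X in _ - X]big1 => [|d /eqP dr]; last by rewrite amp0 // mul0r.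
  by rewrite subr0 -[RHS]root_sum; apply: eq_bigr => d dr; rewrite ampE dr.
(* Outgoing and incoming terms expand into the same double sum over consecutive darts meeting at
   [v]. *)
apply/eqP; rewrite subr_eq0; apply/eqP.
under [RHS]eq_bigr do rewrite sin_head_angle mulrA mulr_sumr.
under [LHS]eq_bigr => d /eqP dv do rewrite amptan ?dv //.
rewrite (exchange_big_dep (fun d => dart_head d == v)) /=.
  apply: eq_bigr => d /eqP dv; apply: eq_bigl => e.
  by rewrite /onward dv andbA andbb.
by move=> d e /eqP <- /andP[/eqP <-].
Qed.

End Root.

(** At the common threshold both branch solutions vanish at the vertex; amplitudes 1 and -1 on [d1]
    and [d2], and 0 elsewhere, cancel in the vertex condition. *)
Lemma vertex_mode d1 d2 : d1 != d2 -> dart_tail d1 = dart_tail d2 ->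
  p d1 = p d2 -> (forall d, dart_tail d = dart_tail d1 -> p d1 <= p d) ->
  nontrivial_mode G (p d1).
Proof.
move=> d12 td pd pmin; have [p0 Ap1 _ _ _] := thr d1.
have Ap2 : A d2 (p d1) = pi / 2 by rewrite pd; have [] := thr d2.
pose c (d : dart G) : R := (d == d1)%:R - (d == d2)%:R.
have c0 d : d != d1 -> d != d2 -> c d = 0.
  by move=> /negbTE n1 /negbTE n2; rewrite /c n1 n2 subr0.
have c1 : c d1 = 1 by rewrite /c eqxx (negbTE d12) subr0.
have c2 : c d2 = -1 by rewrite /c eqxx eq_sym (negbTE d12) sub0r.
have [||||F [beta [modeF _ bE]]] := @root_mode (dart_tail d1) (p d1) 0 c.
- exact: ltW.
- by move=> d /pmin; exact: below_threshold.
- move=> d _; have [->|n1] := eqVneq d d1; first by rewrite Ap1 cos_pihalf mulr0.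
  have [->|n2] := eqVneq d d2; first by rewrite Ap2 cos_pihalf mulr0.
  by rewrite c0 // mul0r.
- rewrite (bigD1 d1) //= (bigD1 d2) /=; last by rewrite td eqxx eq_sym.
  rewrite big1 => [|d /andP[/andP[_ n1] n2]]; last by rewrite c0 // mul0r.
  by rewrite c1 c2 Ap1 Ap2 mulN1r mul1r addr0 subrr.
exists F, beta; split => //; exists d1; right.
by rewrite bE // c1 Ap1 sin_pihalf mul1r oner_neq0.
Qed.

(** The total angle [pi] means that the two branches prescribe matching data at the tail of [d]. The
    value there is [cos t], and [d] takes amplitude -1 because [cos (pi - t) = - cos t]. *)
Lemma edge_mode d k : 0 <= k -> below p d k -> below p (flip d) k ->
  k * len d.1 + theta d k + theta (flip d) k = pi -> nontrivial_mode G k.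
Proof.
move=> k0 bd bf Spi; set t := theta (flip d) k.
have AE : A d k = pi - t by rewrite angleE -Spi /t; ring.
pose c e := if e == d then -1 else cos t / cos (A e k).
have cos_n0 e : onward (flip d) e -> cos (A e k) != 0.
  by move=> /bf ?; apply/lt0r_neq0/cos_angle_gt0.
have cE e : onward (flip d) e -> c e = cos t / cos (A e k).
  by rewrite onwardE => /andP[_ /negbTE]; rewrite /c => ->.
have cd : c d = -1 by rewrite /c eqxx.
have cosA : cos (A d k) = - cos t by rewrite AE addrC cosDpi cosN.
have sinA : sin (A d k) = sin t by rewrite AE addrC sinDpi sinN opprK.
have [||||F [beta [modeF Fr _]]] := @root_mode (dart_tail d) k (cos t) c.
- by [].
- move=> e ed; have [->//|ne] := eqVneq e d.
  by apply: (below_onward bf); rewrite onwardE ed eqxx ne.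
- move=> e ed; have [->|ne] := eqVneq e d; first by rewrite cd cosA mulrNN mul1r.
  have od : onward (flip d) e by rewrite onwardE ed eqxx ne.
  by rewrite cE // divfK // cos_n0.
- rewrite sum_tail cd sinA mulN1r.
  under eq_bigr => e od do rewrite cE // -mulrA [_^-1 * _]mulrC -/(tan _).
  by rewrite -mulr_sumr -sin_head_angle addNr.
exists F, beta; split => //; exists d; left.
by rewrite Fr lt0r_neq0 // cos_head_angle_gt0.
Qed.

End Modes.

(** * Modes of low frequency *)

Section Descent.
Context {R : realType} {G : metric_graph R}.
Context (acyclic : forall c : seq (dart G), ~~ is_cycle c).
Context (A : dart G -> R -> R) (p : dart G -> R).
Context (angleE : branch_angle A) (angle0 : forall d, A d 0 = 0).
Context (thr : forall d, threshold_at A p d).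
Implicit Types (d : dart G).
Local Notation theta := (head_angle A).

Definition low_mode (K : R) := exists k, [/\ 0 < k, k < K & nontrivial_mode G k].

(** The total angle is continuous in [k] and 0 at [k = 0], so it equals [pi] before [k1], and
    [edge_mode] applies there. *)
Lemma edge_angle_mode d k1 : 0 <= k1 -> below p d k1 -> below p (flip d) k1 ->
  pi < k1 * len d.1 + theta d k1 + theta (flip d) k1 -> low_mode k1.
Proof.
move=> k10 bd bf Sk1; have pi0 := @pi_gt0 R.
pose S k := A d k + theta (flip d) k.
have SE k : S k = k * len d.1 + theta d k + theta (flip d) k by rewrite /S angleE.
have bel e k : below p e k1 -> k <= k1 -> below p e k.
  by move=> be kk e' ee'; apply: le_lt_trans kk (be _ ee').
have S0 : S 0 = 0.
  by rewrite /S angle0 add0r /head_angle big1 ?atan0 // => e _; rewrite angle0 tan0.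
have [|||k /andP[k0 kk1] Sk] := @continuous_IVT R S 0 k1 pi => //.
- move=> k /andP[k0 kk1]; apply: cvgD.
    by apply: (angle_continuous angleE angle0 (fun d' _ => thr d')) => //; exact: bel.
  by apply: (head_angle_continuous angle0 (fun d' _ => thr d')) => //; exact: bel.
- by rewrite S0 SE (ltW pi0) (ltW Sk1).
exists k; split.
- by rewrite lt_neqAle k0 andbT; apply: contraTneq pi0 => e; rewrite -Sk -e S0 ltxx.
- by rewrite lt_neqAle kk1 andbT; apply: contraTneq Sk1 => e; rewrite -e -SE Sk ltxx.
by apply: (edge_mode acyclic angleE angle0 thr k0 (bel d k bd kk1) (bel _ k bf kk1)); rewrite -SE.
Qed.

(** As [k] approaches [p o], the branch behind the tail of [d] contributes an angle near [pi / 2],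
    while [A d k] has exceeded [pi / 2] by a definite amount since [p d]. *)
Lemma edge_crossing d o : onward (flip d) o -> p d < p o ->
  (forall e, onward d e -> p o <= p e) ->
  (forall e, onward (flip d) e -> p o <= p e) -> low_mode (p o).
Proof.
move=> od pdo mind minf; have l0 := len_gt0 d.1.
have [p0 Ap _ _ _] := thr d.
(* For every [k1 >= k0] the excess of [A d k1] over [pi / 2] is at least [2 * eps], more than the
   deficit [eps] allowed for [A o k1]. *)
pose k0 := (p d + p o) / 2; pose eps := (k0 - p d) * len d.1 / 2.
have k0p : p d < k0 by rewrite /k0; lra.
have eps0 : 0 < eps by rewrite divr_gt0 // mulr_gt0 // subr_gt0.
have k00 : 0 <= k0 by rewrite ltW // (lt_trans p0).
have k0o : k0 < p o by rewrite /k0; lra.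
have [k1 [k01 k1p Ak1]] := near_threshold angle0 (thr o) k00 k0o eps0.
have k10 : 0 <= k1 by rewrite ltW // (lt_le_trans (lt_trans p0 k0p)).
have bd : below p d k1 by move=> e /mind; exact: lt_le_trans.
have bf : below p (flip d) k1 by move=> e /minf; exact: lt_le_trans.
have [|k [kgt klt km]] := edge_angle_mode k10 bd bf; last first.
  by exists k; split => //; apply: lt_trans k1p.
rewrite -angleE.
have := angle_mono angleE angle0 (fun d' _ => thr d') (ltW p0) (ltW (lt_le_trans k0p k01)) bd.
have := head_angle_ge angle0 (fun d' _ => thr d') k10 bf od.
rewrite Ap; have : 2 * eps <= (k1 - p d) * len d.1.
  by rewrite /eps mulrC divfK ?pnatr_eq0 // ler_pM2r // lerD2r.
by move: Ak1 eps0; lra.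
Qed.

(** Induction along the walk of smallest thresholds; in the proof [o] is the runner-up at the tail
    of [d]. *)
Lemma descent K d : (forall e, dart_tail e = dart_tail d -> p d <= p e) ->
  (exists o, [/\ dart_tail o = dart_tail d, o != d & p o < K]) -> low_mode K.
Proof.
elim/(onward_ind acyclic): d => d IH dmin [a0 [a0d a0n a0K]].
have pd0 : 0 < p d by case: (thr d).
have a0f : onward (flip d) a0 by rewrite onwardE a0d a0n eqxx.
case: (@arg_minP _ _ _ a0 (onward (flip d)) p a0f) => o od omin.
have oK : p o < K by apply: le_lt_trans a0K; exact: omin.
have {a0 a0d a0n a0K a0f} [ot on] : dart_tail o = dart_tail d /\ o != d.
  by move: od; rewrite onwardE => /andP[/eqP].
have := dmin _ ot; rewrite le_eqVlt => /predU1P[tie|pdo].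
  exists (p d); split => //; first by rewrite tie.
  by apply: (vertex_mode acyclic angleE angle0 thr (d1 := d) (d2 := o)) => //; rewrite eq_sym.
have pfo : p (flip d) < p o by have [_ _ + _ _] := thr (flip d); apply.
(* If no dart after [d] has a threshold below [p o], the crossing lies on the edge of [d]. *)
have [ge|] := pselect (forall e, onward d e -> p o <= p e).
  have [k [k0 ko km]] := edge_crossing od pdo ge omin.
  by exists k; split => //; exact: lt_trans oK.
move=> /existsNP[m0 /not_implyP[dm0 /negP]]; rewrite -ltNge => pm0.
case: (@arg_minP _ _ _ m0 (onward d) p dm0) => m dm mmin.
have pmo : p m < p o by apply: le_lt_trans pm0; exact: mmin.
have pm_gt0 : 0 < p m by case: (thr m).
have mK : p m < K by apply: lt_trans oK.
have mt : dart_tail m = dart_head d by case/andP: (dm) => /eqP.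
have mf : m != flip d by case/andP: (dm).
(* Either the crossing is found on the same edge read from its head, or [m] is smallest at the head
   with [flip d] as a competitor below [K], and the walk moves on to [m]. *)
have [pfm|pmf] := ltP (p (flip d)) (p m).
  have dm' : onward (flip (flip d)) m by rewrite flipK.
  have [||k [k0 ko km]] := edge_crossing dm' pfm.
  - by move=> e /omin; apply: le_trans; exact: ltW.
  - by move=> e; rewrite flipK; exact: mmin.
  by exists k; split => //; exact: lt_trans mK.
apply: (IH m dm).
  move=> e; rewrite mt => et; have [->//|ef] := eqVneq e (flip d).
  by apply: mmin; rewrite /onward et eqxx.
exists (flip d); rewrite tail_flip mt eq_sym; split => //.
exact: lt_trans oK.
Qed.

(** The dart of smallest threshold at the vertex differs from one of [d1], [d2], which serves as the
    competitor in [descent]. *)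
Lemma two_low_darts K d1 d2 : dart_tail d1 = dart_tail d2 -> d1 != d2 ->
  p d1 < K -> p d2 < K -> low_mode K.
Proof.
move=> t12 n12 p1 p2.
have h1 : (fun d => dart_tail d == dart_tail d1) d1 by exact: eqxx.
case: (@arg_minP _ _ _ d1 (fun d => dart_tail d == dart_tail d1) p h1) => m /eqP mt mmin.
apply: (@descent K m); first by move=> e et; apply: mmin; rewrite et mt.
have [md1|md1] := eqVneq m d1; last by exists d1; rewrite mt eq_sym.
by exists d2; rewrite md1 eq_sym.
Qed.

Lemma mode_reverse k F beta d s : mode k F beta ->
  F (dart_tail (flip d)) * cos (k * (len d.1 - s)) +
    beta (flip d) * sin (k * (len d.1 - s)) =
    F (dart_tail d) * cos (k * s) + beta d * sin (k * s) /\
  F (dart_tail (flip d)) * sin (k * (len d.1 - s)) -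
    beta (flip d) * cos (k * (len d.1 - s)) =
    beta d * cos (k * s) - F (dart_tail d) * sin (k * s).
Proof.
move=> [hd fl _]; rewrite tail_flip hd fl mulrBr cosB sinB.
by split; rewrite -[RHS]mulr1 -(cos2Dsin2 (k * len d.1)); ring.
Qed.

Lemma vertex_low_mode K F beta d1 d2 : 0 < K -> mode K F beta ->
  dart_tail d1 = dart_tail d2 -> d1 != d2 ->
  F (dart_tail d1) != 0 -> beta d1 = 0 -> beta d2 = 0 -> low_mode K.
Proof.
move=> K0 modeF t12 n12 Fn b1 b2.
have low d : dart_tail d = dart_tail d1 -> beta d = 0 -> p d < K.
  move=> td bd; apply: (@critical_threshold _ _ acyclic _ _ angleE angle0 thr K F beta d 0) => //.
  - by rewrite lexx len_gt0.
  - by rewrite td bd mul0r addr0 mulr0 cos0 mulr1.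
  - by rewrite bd mul0r mulr0 sin0 mulr0.
by apply: (two_low_darts t12 n12); apply: low.
Qed.

(** If all thresholds around the edge exceed [K], [critical_angle] from both ends gives a total
    angle of at least [2 * pi]. Otherwise orient the edge so that the smallest such dart [m] starts
    at its tail: if the edge has a smaller threshold there is a crossing, and if not, both
    thresholds lie below [K]. *)
Lemma edge_low_mode K F beta d s : 0 < K -> mode K F beta -> 0 < s < len d.1 ->
  F (dart_tail d) * cos (K * s) + beta d * sin (K * s) != 0 ->
  beta d * cos (K * s) = F (dart_tail d) * sin (K * s) -> low_mode K.
Proof.
move=> K0 modeF; have pi0 := @pi_gt0 R.
have aux a t m : 0 <= t < len a.1 ->
    F (dart_tail a) * cos (K * t) + beta a * sin (K * t) != 0 ->
    beta a * cos (K * t) = F (dart_tail a) * sin (K * t) ->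
    onward (flip a) m -> p m <= K ->
    (forall e, onward a e || onward (flip a) e -> p m <= p e) -> low_mode K.
  move=> ta val der am mK mmin.
  have [pam|pma] := ltP (p a) (p m).
    have [||k [k0 kp km]] := edge_crossing am pam.
    - by move=> e ae; apply: mmin; rewrite ae.
    - by move=> e ae; apply: mmin; rewrite ae orbT.
    by exists k; split => //; exact: lt_le_trans mK.
  have pK := critical_threshold acyclic angleE angle0 thr modeF K0 ta val der.
  move: am; rewrite onwardE => /andP[/eqP mt mn].
  by apply: (two_low_darts mt mn) => //; apply: le_lt_trans pK.
move=> /andP[s0 sl] val der.
have [valf derf] := mode_reverse d s modeF.
have val' : F (dart_tail (flip d)) * cos (K * (len d.1 - s)) +
    beta (flip d) * sin (K * (len d.1 - s)) != 0 by rewrite valf.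
have der' : beta (flip d) * cos (K * (len d.1 - s)) =
    F (dart_tail (flip d)) * sin (K * (len d.1 - s)).
  by move: derf; rewrite der subrr => /eqP; rewrite subr_eq0 => /eqP.
have sd : 0 <= s < len d.1 by rewrite ltW.
have sf : 0 <= len d.1 - s < len (flip d).1.
  by rewrite subr_ge0 ltW //= ltrBlDr ltrDl.
have [bel|] := pselect (forall e, onward d e || onward (flip d) e -> K < p e).
  have bd : below p d K by move=> e de; apply: bel; rewrite de.
  have bf : below p (flip d) K by move=> e de; apply: bel; rewrite de orbT.
  apply: (edge_angle_mode (ltW K0) bd bf).
  have := critical_angle acyclic angleE angle0 thr modeF K0 sd bd val der.
  have := critical_angle acyclic angleE angle0 thr modeF K0 sf bf val' der'.
  by rewrite /= mulrBr; lra.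
move=> /existsNP[m0 /not_implyP[dm0 /negP]]; rewrite -leNgt => pm0.
case: (@arg_minP _ _ _ m0 (fun e => onward d e || onward (flip d) e) p dm0) => m dm mmin.
have mK : p m <= K by apply: le_trans pm0; exact: mmin.
case/orP: dm => dm; last exact: (aux d s m).
apply: (aux (flip d) (len d.1 - s) m) => //; rewrite flipK // => e.
by rewrite orbC; exact: mmin.
Qed.

End Descent.

(** * Waves on an interval *)

Section Wave.
Context {R : realType}.
Local Notation mu := (@lebesgue_measure R).

Definition wave (k a b x : R) : R := a * cos (k * x) + b * sin (k * x).

Lemma wave_is_derive (k a b x : R) :
  is_derive x 1 (wave k a b) (wave k (k * b) (- (k * a)) x).
Proof.
rewrite /wave; apply: is_derive_eq.
by rewrite /GRing.scale /=; ring.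
Qed.

Lemma wave_continuous (k a b : R) : continuous (wave k a b).
Proof.
move=> x; apply/differentiable_continuous/derivable1_diffP.
by have [] := wave_is_derive k a b x.
Qed.

Lemma wave_derive2 (k a b x : R) :
  wave k (k * - (k * a)) (- (k * (k * b))) x = - (k ^+ 2 * wave k a b x).
Proof. by rewrite /wave; ring. Qed.

Lemma continuous_in_L2 (l : R) (u : R -> R) : continuous u -> in_L2 l u.
Proof.
move=> cu; have mI : measurable (`]0, l[%classic : set R) by exact: measurable_itv.
have mu_u : measurable_fun setT u by apply: measurable_realfun.continuous_measurable_fun.
have mu_uI : measurable_fun setT (u \_ `]0, l[).
  by apply/(measurable_restrict _ mI measurableT); apply: measurable_funS mu_u.
rewrite /in_L2 inE; apply/andP; split; rewrite inE //=.
rewrite /finite_norm unlock poweR_lty //.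
have int_cc : mu.-integrable `[0, l] (EFin \o (fun x => `|u x| `^ 2)).
  apply: continuous_compact_integrable; first exact: segment_compact.
  apply: continuous_subspaceT => x; under eq_fun do rewrite powR_mulrn // expr2.
  by apply: cvgM; apply: cvg_norm; exact: cu.
have : mu.-integrable `]0, l[ (EFin \o (fun x => `|u x| `^ 2)).
  by apply: integrableS int_cc => //; exact: subset_itv_oo_cc.
move=> /integrableP[_]; apply: le_lt_trans.
rewrite [leRHS]integral_mkcond le_eqVlt; apply/orP; left; apply/eqP.
apply: eq_integral => x _; rewrite /patch.
case: ifP => xI /=; case: ifP => xI' /=.
- by rewrite (ger0_norm (powR_ge0 _ _)).
- by case: (elimF idP xI' xI).
- by case: (elimF idP xI xI').
by rewrite normr0 powR0 // pnatr_eq0.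
Qed.

Lemma Rintegral_oo_cc (l : R) (f : R -> R) : {within `[0, l], continuous f} ->
  (\int[mu]_(x in `]0, l[) f x = \int[mu]_(x in `[0, l]) f x)%R.
Proof.
move=> cf; have int_cc : mu.-integrable `[0, l] (EFin \o f).
  by apply: continuous_compact_integrable => //; exact: segment_compact.
rewrite Rintegral_itv_obnd_cbnd ?Rintegral_itv_bndo_bndc //.
- by apply: integrableS int_cc => //; exact: subset_itv_co_cc.
- by apply: integrableS int_cc => //; exact: subset_itv_oo_cc.
Qed.

Lemma test_derivable (l : R) (phi : R -> R) (n : nat) (x : R) : test_function l phi ->
  is_derive x 1 (derive1n n phi) (derive1n n.+1 phi x).
Proof.
move=> [sm _]; apply: DeriveDef; first exact: sm.
by rewrite derive1nS derive1E.
Qed.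

Lemma test_continuous (l : R) (phi : R -> R) n : test_function l phi ->
  continuous (derive1n n phi).
Proof.
move=> tphi x; apply/differentiable_continuous/derivable1_diffP.
by have [] := test_derivable n x tphi.
Qed.

Lemma test_boundary (l : R) (phi : R -> R) : test_function l phi ->
  phi 0 = 0 /\ phi l = 0.
Proof.
move=> [_ [a [b [a0 bl supp]]]]; split; apply: contrapT => /eqP /supp /andP[].
  by rewrite leNgt a0.
by rewrite [l <= b]leNgt bl.
Qed.

Lemma derivable_LRcontinuous (f : R -> R) (a b : R) : (forall x : R, derivable f x 1) ->
  derivable_oo_LRcontinuous f a b.
Proof.
move=> df; have cf : continuous f.
  by move=> x; apply/differentiable_continuous/derivable1_diffP.
by split => //; [apply: cvg_at_right_filter|apply: cvg_at_left_filter]; exact: cf.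
Qed.

(** Integration by parts; the boundary terms vanish with the test function. *)
Lemma weak_derivative_C1 (l : R) (u v : R -> R) : 0 < l ->
  (forall x : R, is_derive x 1 u (v x)) -> continuous v -> weak_derivative l u v.
Proof.
move=> l0 du cv phi tphi; have [phi0 phil] := test_boundary tphi.
have cu : continuous u.
  move=> x; apply/differentiable_continuous/derivable1_diffP.
  by have [] := du x.
have cphi : continuous phi := @test_continuous l phi 0 tphi.
have cphi' : continuous (derive1 phi) := @test_continuous l phi 1 tphi.
rewrite !Rintegral_oo_cc; first last.
- by apply: continuous_subspaceT => x; apply: cvgM; [exact: cu|exact: cphi'].
- by apply: continuous_subspaceT => x; apply: cvgM; [exact: cv|exact: cphi].
rewrite (@Rintegration_by_parts R u phi v) //.
- by rewrite phi0 phil !mulr0 subrr sub0r.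
- exact: continuous_subspaceT.
- by apply: derivable_LRcontinuous => x; have [] := du x.
- by move=> x _; rewrite derive1E; have [_] := du x.
- exact: continuous_subspaceT.
- by apply: derivable_LRcontinuous => x; have [] := @test_derivable l phi 0 x tphi.
Qed.

Lemma wave_H2 (l k a b : R) (u : R -> R) : 0 < l ->
  (forall x, 0 < x < l -> u x = wave k a b x) ->
  H2_second_derivative l u (fun x => - (k ^+ 2 * wave k a b x)).
Proof.
move=> l0 uE.
have -> : (fun x => - (k ^+ 2 * wave k a b x)) =
    wave k (k * - (k * a)) (- (k * (k * b))).
  by apply/funext => x; rewrite wave_derive2.
split; last (exists (wave k (k * b) (- (k * a))); split).
- have uw : u \_ `]0, l[ = wave k a b \_ `]0, l[.
    apply/funext => x; rewrite !patchE; case: ifP => // /set_mem.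
    by rewrite /= in_itv => /uE.
  by rewrite /in_L2 uw; exact/continuous_in_L2/wave_continuous.
- exact/continuous_in_L2/wave_continuous.
- exact/continuous_in_L2/wave_continuous.
- move=> phi tphi.
  rewrite -(weak_derivative_C1 l0 (wave_is_derive k a b) _ tphi); last exact: wave_continuous.
  by apply: eq_Rintegral => x /set_mem; rewrite /= in_itv => /uE ->.
- apply: weak_derivative_C1 => //; last exact: wave_continuous.
  exact: wave_is_derive.
Qed.

Lemma right_derivative_wave (l k a b : R) (u : R -> R) : 0 < l ->
  (forall x, 0 <= x <= l -> u x = wave k a b x) -> right_derivative u 0 = k * b.
Proof.
move=> l0 uE; apply: cvg_lim => //.
have [/= dw wE] := wave_is_derive k a b 0.
have : (fun h => h^-1 *: (wave k a b (h *: 1 + 0) - wave k a b 0)) @ 0^'+ --> k * b.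
  have -> : k * b = 'D_1 (wave k a b) 0.
    by rewrite wE /wave !mulr0 cos0 sin0 mulr1 mulr0 addr0.
  by apply: cvg_dnbhs_at_right dw.
apply: cvg_trans; apply: near_eq_cvg; near=> h.
have h0 : 0 < h by near: h; exact: nbhs_right_gt.
have hl : h < l by near: h; exact: nbhs_right_lt.
by rewrite /GRing.scale /= mulr1 addr0 add0r !uE ?lexx ?ltW.
Unshelve. all: by end_near. Qed.

Lemma left_derivative_wave (l k a b : R) (u : R -> R) : 0 < l ->
  (forall x, 0 <= x <= l -> u x = wave k a b x) ->
  left_derivative u l = k * (b * cos (k * l) - a * sin (k * l)).
Proof.
move=> l0 uE; apply: cvg_lim => //.
have [/= dw wE] := wave_is_derive k a b l.
have : (fun h => h^-1 *: (wave k a b (h *: 1 + l) - wave k a b l)) @ 0^'- -->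
    k * (b * cos (k * l) - a * sin (k * l)).
  have -> : k * (b * cos (k * l) - a * sin (k * l)) = 'D_1 (wave k a b) l.
    by rewrite wE /wave; ring.
  by apply: cvg_dnbhs_at_left dw.
apply: cvg_trans; apply: near_eq_cvg; near=> h.
have h0 : h < 0 by near: h; exact: nbhs_left_lt.
have hl : - l < h by near: h; apply: nbhs_left_gt; rewrite oppr_lt0.
have hb : 0 <= l + h <= l by apply/andP; split; lra.
by rewrite /GRing.scale /= mulr1 [h + l]addrC !uE // ?lexx ?ltW.
Unshelve. all: by end_near. Qed.

End Wave.

(** * Modes and eigenfunctions *)

Section ModeEigenfunctions.
Context {R : realType} {G : metric_graph R}.
Implicit Types (e : edge G) (t : R) (f : graph_point G -> R).

Lemma edge_point_src e : edge_point e 0 = vertex_point (src e).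
Proof. by rewrite /edge_point insubN ?ltxx // lexx. Qed.

Lemma edge_point_tgt e : edge_point e (len e) = vertex_point (tgt e).
Proof. by rewrite /edge_point insubN ?ltxx ?andbF // leNgt len_gt0. Qed.

Lemma edge_point_inner e t (t_in : 0 < t < len e) :
  edge_point e t = inr (existT _ e (exist _ t t_in)).
Proof. by rewrite /edge_point insubT. Qed.

Lemma sum_darts (P : pred (dart G)) (g : dart G -> R) :
  \sum_(d | P d) g d =
  \sum_(e | P (e, true)) g (e, true) + \sum_(e | P (e, false)) g (e, false).
Proof.
rewrite [X in X + _]big_mkcond [X in _ + X]big_mkcond -big_split /=.
rewrite big_mkcond.
rewrite (eq_bigr (fun d => if P (d.1, d.2) then g (d.1, d.2) else 0)); last by case.
rewrite -(pair_bigA _ (fun e b => if P (e, b) then g (e, b) else 0)) /=.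
by apply: eq_bigr => e _; rewrite big_bool.
Qed.

Definition wave_edges k f (beta : dart G -> R) := forall e t, 0 <= t <= len e ->
  on_edge f e t = wave k (f (vertex_point (src e))) (beta (e, true)) t.

(** At either end of an edge the derivative pointing into the vertex is [- k] times [beta] of the
    dart leaving it. *)
Lemma wave_edges_kirchhoff k f beta v : wave_edges k f beta ->
  (forall d, beta (flip d) = f (vertex_point (dart_tail d)) * sin (k * len d.1)
     - beta d * cos (k * len d.1)) ->
  k != 0 -> kirchhoff f v <-> \sum_(d | dart_tail d == v) beta d = 0.
Proof.
move=> fE fl k0; rewrite sum_darts /kirchhoff.
under eq_bigr do rewrite (right_derivative_wave (len_gt0 _) (fE _)).
under [X in _ + X = 0 <-> _]eq_bigr => e _.
  rewrite (left_derivative_wave (len_gt0 _) (fE _)) -opprB -(fl (e, true)) mulrN.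
  over.
rewrite !sumrN -opprD -!mulr_sumr -mulrDr.
split => [/eqP|->]; last by rewrite mulr0 oppr0.
by rewrite oppr_eq0 mulf_eq0 (negbTE k0) => /eqP.
Qed.

Lemma mode_eigenvalue k : 0 < k -> nontrivial_mode G k ->
  eigenvalue_of_laplacian G (k ^+ 2).
Proof.
move=> k0 [F [beta [[hd fl sm] [d0 nz]]]].
pose f (x : graph_point G) := match x with
  | inl v => F v
  | inr (existT e t) => wave k (F (src e)) (beta (e, true)) (val t)
  end.
have fE : wave_edges k f beta.
  move=> e t /andP[t0 tl]; rewrite /on_edge.
  have [<-|tn0] := eqVneq 0 t.
    by rewrite edge_point_src /wave mulr0 cos0 sin0 mulr1 mulr0 addr0.
  have [->|tnl] := eqVneq t (len e).
    by rewrite edge_point_tgt; exact: (hd (e, true)).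
  have t_in : 0 < t < len e by rewrite !lt_neqAle tn0 t0 tnl tl.
  by rewrite (edge_point_inner t_in).
have H2 e : H2_second_derivative (len e) (on_edge f e)
    (fun x => - (k ^+ 2 * wave k (F (src e)) (beta (e, true)) x)).
  apply: wave_H2; first exact: len_gt0.
  by move=> x /andP[x0 xl]; rewrite fE // !ltW.
exists f; split; last split.
- apply: contrapT => none; have f0 x : f x = 0.
    by apply: contrapT => /eqP fx; apply: none; exists x.
  have F0 v : F v = 0 by exact: (f0 (inl v)).
  have be e : beta (e, true) = 0.
    (* An interior point at which the sine is nonzero, so that a vanishing function has
       [beta = 0]. *)
    pose t := Num.min (len e / 2) (pi / k / 2).
    have l0 := len_gt0 e; have pk : 0 < pi / k :> R by rewrite divr_gt0 // pi_gt0.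
    have t0 : 0 < t by rewrite lt_min !divr_gt0 ?pi_gt0.
    have tl : t < len e.
      by rewrite gt_min ltr_pdivrMr // ltr_pMr // ltr1n.
    have tpi : 0 < k * t < pi.
      rewrite mulr_gt0 //= mulrC -ltr_pdivlMr // gt_min orbC.
      by rewrite ltr_pdivrMr // ltr_pMr // ltr1n.
    have := fE e t; rewrite (ltW t0) (ltW tl) => /(_ isT) /esym /eqP.
    rewrite /wave /on_edge !f0 mul0r add0r mulf_eq0.
    by rewrite (gt_eqF (sin_gt0_pi tpi)) orbF => /eqP.
  case: nz; first by rewrite F0 eqxx.
  case: d0 => e []; first by rewrite be eqxx.
  by rewrite -[(e, false)]/(flip (e, true)) fl F0 be !mul0r subrr eqxx.
- split=> [e|e|v].
  + apply: (@subspace_eq_continuous _ _ _ (wave k (F (src e)) (beta (e, true)))).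
      by move=> t /set_mem; rewrite /= in_itv => t_in; rewrite [RHS]fE.
    by apply: continuous_subspaceT; exact: wave_continuous.
  + by eexists; exact: H2.
  + by apply/(wave_edges_kirchhoff v fE) => //; rewrite gt_eqF.
- move=> e; eexists; first exact: H2.
  apply: aeW => t /andP[t0 tl]; rewrite opprK /on_edge.
  by rewrite -fE // !ltW.
Qed.

Lemma eigenfunction_mode k f : 0 < k -> (forall v, kirchhoff f v) ->
  (forall e, exists b, forall t, 0 <= t <= len e ->
    on_edge f e t = wave k (f (vertex_point (src e))) b t) ->
  exists beta, mode k (fun v => f (vertex_point v)) beta /\ wave_edges k f beta.
Proof.
move=> k0 kir /choice[b fE].
(* Against the parametrization, [beta] is forced by the reversal rule of [mode]. *)
pose beta (d : dart G) := if d.2 then b d.1 else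
  f (vertex_point (src d.1)) * sin (k * len d.1) - b d.1 * cos (k * len d.1).
have wE : wave_edges k f beta by exact: fE.
have tgtE e : f (vertex_point (tgt e)) =
    wave k (f (vertex_point (src e))) (b e) (len e).
  by rewrite -fE ?lexx ?andbT ?ltW ?len_gt0 // /on_edge edge_point_tgt.
have fl d : beta (flip d) = f (vertex_point (dart_tail d)) * sin (k * len d.1)
    - beta d * cos (k * len d.1).
  case: d => e []; rewrite /beta //= /dart_tail /= tgtE /wave.
  by rewrite -[LHS]mulr1 -(cos2Dsin2 (k * len e)); ring.
exists beta; split => //; split=> //; last first.
  by move=> v; apply/(wave_edges_kirchhoff v wE fl); rewrite ?gt_eqF.
case=> e []; rewrite /dart_head /dart_tail /= tgtE // /beta /= /wave.
by rewrite -[LHS]mulr1 -(cos2Dsin2 (k * len e)); ring.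
Qed.

End ModeEigenfunctions.

(** * Smooth functions and bumps *)

Section Smooth.
Context {R : realType}.
Implicit Types (f g : R -> R) (x : R) (n : nat).

Definition smooth f := forall n x, derivable (derive1n n f) x 1.

(** A coinduction principle: by induction on the order, every iterated derivative stays in [C]. *)
Lemma smooth_class (C : (R -> R) -> Prop) :
  (forall f, C f -> exists f', (forall x, is_derive x 1 f (f' x)) /\ C f') ->
  forall f, C f -> smooth f.
Proof.
move=> der f Cf n.
have derE g : C g -> (forall x, derivable g x 1) /\ C (derive1 g).
  move=> /der[g' [dg Cg']]; split=> [x|]; first by have [] := dg x.
  have -> // : derive1 g = g'.
  by apply/funext => x; rewrite derive1E; have [_] := dg x.
suff [] : (forall x, derivable (derive1n n f) x 1) /\ C (derive1 (derive1n n f)) by [].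
by elim: n => [|n [_ IH]]; [exact: derE|rewrite derive1nS; exact: derE].
Qed.

Lemma smooth_is_derive f x : smooth f -> is_derive x 1 f (derive1 f x).
Proof. by move=> sf; apply: DeriveDef; [exact: (sf 0%N)|rewrite derive1E]. Qed.

Lemma smooth_derive1 f : smooth f -> smooth (derive1 f).
Proof. by move=> sf n x; rewrite -derive1Sn; exact: sf. Qed.

Lemma smooth_primitive f g : (forall x, is_derive x 1 f (g x)) -> smooth g ->
  smooth f.
Proof.
move=> df sg; apply: (@smooth_class (fun h => h = f \/ smooth h)); last by left.
move=> h [->|sh]; first by exists g; split => //; right.
exists (derive1 h); split; last by right; exact: smooth_derive1.
by move=> x; exact: smooth_is_derive.
Qed.

Lemma smooth_continuous f : smooth f -> continuous f.
Proof.
by move=> sf x; apply/differentiable_continuous/derivable1_diffP; exact: (sf 0%N).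
Qed.

(** Unlike single products, these sums are closed under differentiation by the Leibniz rule, as
    [smooth_class] requires. *)
Inductive sum_of_products : (R -> R) -> Prop :=
| SumProd f g : smooth f -> smooth g -> sum_of_products (fun x => f x * g x)
| SumAdd f g : sum_of_products f -> sum_of_products g -> sum_of_products (fun x => f x + g x).

Lemma smooth_sum_of_products f : sum_of_products f -> smooth f.
Proof.
apply: smooth_class => {}f; elim=> [{}f g sf sg|{}f g _ [f' [df Cf]] _ [g' [dg Cg]]].
  exists (fun x => derive1 f x * g x + f x * derive1 g x); split=> [x|]; last first.
    exact: SumAdd (SumProd (smooth_derive1 sf) sg) (SumProd sf (smooth_derive1 sg)).
  have := smooth_is_derive x sf; have := smooth_is_derive x sg => ? ?.
  by apply: is_derive_eq; rewrite /GRing.scale /=; ring.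
exists (fun x => f' x + g' x); split=> [x|]; last exact: SumAdd Cf Cg.
by have := df x; have := dg x => ? ?; apply: is_deriveD.
Qed.

Lemma smoothM f g : smooth f -> smooth g -> smooth (fun x => f x * g x).
Proof. by move=> sf sg; apply/smooth_sum_of_products/SumProd. Qed.

Lemma smooth_cst (c : R) : smooth (fun=> c).
Proof.
apply: (@smooth_class (fun h => exists c, h = fun=> c)); last by exists c.
by move=> _ [c' ->]; exists (fun=> 0); split; [move=> x; exact: is_derive_cst|exists 0].
Qed.

Lemma smoothD f g : smooth f -> smooth g -> smooth (fun x => f x + g x).
Proof.
have one h : smooth h -> sum_of_products h.
  move=> sh; have -> : h = (fun x => h x * 1) by apply/funext => x /=; rewrite mulr1.
  exact: SumProd sh (@smooth_cst 1).
by move=> sf sg; apply/smooth_sum_of_products/SumAdd; exact: one.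
Qed.

Lemma smooth_affine f (c d : R) : smooth f -> smooth (fun x => f (c * x + d)).
Proof.
move=> sf; pose C h := exists m g, smooth g /\ h = fun x => m * g (c * x + d).
apply: (@smooth_class C); last by exists 1, f; split => //; apply/funext => x; rewrite mul1r.
move=> _ [m [g [sg ->]]]; exists (fun x => m * c * derive1 g (c * x + d)).
split; last by exists (m * c), (derive1 g); exact: conj (smooth_derive1 sg) erefl.
move=> x; have dg := smooth_is_derive (c * x + d) sg.
have da : is_derive x 1 (fun x : R => c * x + d) c.
  by apply: is_derive_eq; rewrite /GRing.scale /=; ring.
have dcomp := @is_derive1_comp _ g (fun x => c * x + d) _ _ _ dg da.
have dcomp' : is_derive x 1 (fun x => g (c * x + d)) (derive1 g (c * x + d) * c) := dcomp.
by apply: is_derive_eq; rewrite /GRing.scale /=; ring.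
Qed.

Lemma smooth_wave (k a b : R) : smooth (wave k a b).
Proof.
apply: (@smooth_class (fun h => exists a b, h = wave k a b)); last by exists a, b.
move=> _ [a' [b' ->]]; exists (wave k (k * b') (- (k * a'))); split; last by do 2!eexists.
by move=> x; exact: wave_is_derive.
Qed.

(** The powers of [x^-1] make the span of the family closed under differentiation. *)
Definition flat n x : R := if 0 < x then x^-1 ^+ n * expR (- x^-1) else 0.

Lemma flat_ge0 n x : 0 <= flat n x.
Proof.
rewrite /flat; case: ifP => // x0.
by rewrite mulr_ge0 ?expR_ge0 // exprn_ge0 // invr_ge0 ltW.
Qed.

(** A single term of the exponential series, [y ^ (n + 2) / (n + 2)! <= exp y] at [y = x^-1]. The
    square yields the zero derivative at 0. *)
Lemma flat_le n x : flat n x <= (n.+2)`!%:R * x ^+ 2.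
Proof.
rewrite /flat; case: ifP => [x0|_]; last by rewrite mulr_ge0 // sqr_ge0.
have y0 : 0 < x^-1 by rewrite invr_gt0.
have := expR_ge1Dxn n.+1 (ltW y0); set y := x^-1 in y0 *.
have fac : 0 < (n.+2)`!%:R :> R by rewrite ltr0n fact_gt0.
move=> /(le_trans (_ : y ^+ n.+2 / (n.+2)`!%:R <= _)); rewrite lerDr => /(_ ler01).
rewrite ler_pdivrMr // => h.
have yx : y ^+ 2 * x ^+ 2 = 1 by rewrite -exprMn mulVf ?expr1n // gt_eqF.
rewrite -[leLHS]mulr1 -[X in _ * X <= _]yx mulrA (mulrAC (y ^+ n)) -exprD addn2; apply: ler_wpM2r; first exact: sqr_ge0.
by rewrite expRN ler_pdivrMr ?expR_gt0 // [leRHS]mulrC.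
Qed.

Lemma is_derive_flat n x :
  is_derive x 1 (flat n) (flat n.+2 x - n%:R * flat n.+1 x).
Proof.
have [x0|x0|->] := ltrgtP x 0.
- have z m : flat m x = 0 by rewrite /flat ltNge ltW.
  rewrite !z mulr0 subr0; apply: (@near_eq_is_derive _ _ _ (fun=> 0)).
  near=> y; rewrite /flat ifF //; apply/negbTE; rewrite -leNgt ltW //.
  by near: y; exact: lt_nbhsl.
- have dV : is_derive x 1 (fun y : R => y^-1) (- x ^- 2).
    have := @is_deriveV _ id x 1 1 (lt0r_neq0 x0) _ => h.
    by apply: is_derive_eq; rewrite /GRing.scale /= mulr1.
  have dE : is_derive x 1 (fun y : R => expR (- y^-1)) (expR (- x^-1) * x ^- 2).
    have dN : is_derive x 1 (fun y : R => - y^-1) (x ^- 2).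
      by apply: is_derive_eq; rewrite opprK.
    exact: (is_derive1_comp (is_derive_expR _) dN).
  have dX : is_derive x 1 (fun y : R => y^-1 ^+ n) (n%:R * x^-1 ^+ n.-1 * - x ^- 2).
    by have := @is_deriveX _ _ _ n _ _ _ dV; rewrite exprfctE.
  have dM : is_derive x 1 (fun y : R => y^-1 ^+ n * expR (- y^-1))
      (flat n.+2 x - n%:R * flat n.+1 x).
    apply: is_derive_eq; rewrite /GRing.scale /= /flat x0 -exprVn.
    by case: n {dX} => [|n] /=; rewrite ?exprS ?expr0; ring.
  apply: near_eq_is_derive dM; near=> y; rewrite /flat ifT //.
  by near: y; exact: lt_nbhsr.
have f0 m : flat m 0 = 0 by rewrite /flat ltxx.
rewrite !f0 mulr0 subr0.
(* By [flat_le] the difference quotient at 0 is bounded by a multiple of [|h|]. *)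
suff h : (fun h => h^-1 *: (flat n (h *: 1 + 0) - flat n 0)) @ 0^' --> (0 : R).
  by apply: DeriveDef; [apply/cvg_ex; exists 0|apply: cvg_lim].
apply/cvgr0Pnorm_le => e e0; near=> h.
have hn : h != 0 by near: h; exact: nbhs_dnbhs_neq.
rewrite f0 subr0 addr0 /GRing.scale /= mulr1 normrM normfV ler_pdivrMl ?normr_gt0 //.
rewrite ger0_norm ?flat_ge0 //; apply: le_trans (flat_le _ _) _.
rewrite -real_normK ?num_real // expr2 mulrA [leRHS]mulrC ler_pM2r ?normr_gt0 //.
rewrite mulrC -ler_pdivlMr ?ltr0n ?fact_gt0 //.
near: h; apply: dnbhs0_le; rewrite divr_gt0 // ltr0n fact_gt0 //.
Unshelve. all: by end_near. Qed.

Inductive flat_span : (R -> R) -> Prop :=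
| FlatOne (c : R) n : flat_span (fun x => c * flat n x)
| FlatAdd f g : flat_span f -> flat_span g -> flat_span (fun x => f x + g x).

Lemma smooth_flat n : smooth (flat n).
Proof.
apply: (@smooth_class flat_span); last first.
  have -> : flat n = (fun x => 1 * flat n x) by apply/funext => x; rewrite mul1r.
  exact: FlatOne.
move=> f; elim=> [c m|{}f g _ [f' [df Cf]] _ [g' [dg Cg]]]; last first.
  exists (fun x => f' x + g' x); split=> [x|]; last exact: FlatAdd Cf Cg.
  by have := df x; have := dg x => ? ?; apply: is_deriveD.
exists (fun x => c * flat m.+2 x + - (c * m%:R) * flat m.+1 x).
split=> [x|]; last exact: FlatAdd (FlatOne _ _) (FlatOne _ _).
have := is_derive_flat m x => ?.
by apply: is_derive_eq; rewrite /GRing.scale /=; ring.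
Qed.

Definition bump (a b x : R) : R := flat 0 (x - a) * flat 0 (b - x).

Lemma smooth_bump a b : smooth (bump a b).
Proof.
have -> : bump a b = (fun x => flat 0 (1 * x + - a) * flat 0 (-1 * x + b)).
  by apply/funext => x; rewrite /bump /= mul1r mulN1r [- x + b]addrC.
exact: smoothM (@smooth_affine _ _ _ (@smooth_flat 0%N)) (@smooth_affine _ _ _ (@smooth_flat 0%N)).
Qed.

Lemma bump_support a b x : bump a b x != 0 -> a <= x <= b.
Proof.
rewrite mulf_eq0 negb_or /flat !subr_gt0 => /andP[].
by case: ltP => [/ltW -> _|]; [case: ltP => [/ltW ->|]|]; rewrite ?eqxx.
Qed.

Lemma bump_ge0 a b x : 0 <= bump a b x.
Proof. by rewrite mulr_ge0 // flat_ge0. Qed.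

Lemma bump_gt0 a b x : a < x < b -> 0 < bump a b x.
Proof.
by move=> /andP[ax xb]; rewrite mulr_gt0 // /flat subr_gt0 ?ax ?xb expr0 mul1r expR_gt0.
Qed.

End Smooth.

(** * Weak solutions *)

Section WeakSolutions.
Context {R : realType}.
Local Notation mu := (@lebesgue_measure R).
Implicit Types (g u v w phi psi : R -> R) (a b l k x : R).

Definition supported g a b := forall x, g x != 0 -> a <= x <= b.

Lemma supported_eq0 g a b x : supported g a b -> x < a \/ b < x -> g x = 0.
Proof.
move=> sup out; apply: contrapT => /eqP /sup /andP[ax xb].
by case: out; rewrite ltNge ?ax ?xb.
Qed.

Lemma supported_derive g g' a b : (forall x, is_derive x 1 g (g' x)) ->
  supported g a b -> supported g' a b.
Proof.
move=> dg sup x; apply: contraNT => /negP out.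
have {}out : x < a \/ b < x.
  by have [|ax] := ltP x a; [left|have [|xb] := ltP b x; [right|case: out; rewrite ax]].
have dg0 : is_derive x 1 g 0.
  apply: (@near_eq_is_derive _ _ _ (fun=> 0)); near=> y.
  apply/esym/(supported_eq0 sup); near: y; case: out => h.
    by near=> y; left; near: y; exact: lt_nbhsl.
  by near=> y; right; near: y; exact: lt_nbhsr.
by have [_ <-] := dg x; have [_ ->] := dg0.
Unshelve. all: by end_near. Qed.

Lemma segment_integrable l g : {within `[0, l], continuous g} ->
  mu.-integrable `[0, l] (EFin \o g).
Proof. by apply: continuous_compact_integrable; exact: segment_compact. Qed.

Lemma continuous_integrable l g : continuous g -> mu.-integrable `[0, l] (EFin \o g).
Proof. by move=> cg; apply/segment_integrable/continuous_subspaceT. Qed.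

(** The integral from 0 vanishes before [a] and is constant after [b], where it equals the integral
    over [[0, l]]. *)
Lemma compact_primitive g a b l : continuous g -> 0 < a -> b < l ->
  supported g a b -> (\int[mu]_(x in `[0, l]) g x)%R = 0 ->
  exists G, (forall x, is_derive x 1 G (g x)) /\ supported G a b.
Proof.
move=> cg a0 bl sup ig.
pose G x := (\int[mu]_(t in `[0%R, x]) g t)%R.
have Ga x : x < a -> G x = 0.
  move=> xa; rewrite /G (@eq_Rintegral _ _ _ _ _ (fun=> 0)) ?Rintegral_cst ?mul0r //.
  move=> y /set_mem; rewrite /= in_itv => /andP[_ yx].
  by apply: (supported_eq0 sup); left; exact: le_lt_trans xa.
exists G; split=> [x|x].
  have [xa|ax] := ltP x a.
    rewrite (supported_eq0 sup (or_introl xa)).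
    apply: (@near_eq_is_derive _ _ _ (fun=> 0)); near=> y.
    by rewrite Ga //; near: y; exact: lt_nbhsl.
  have xu : x < x + 1 by rewrite ltrDl.
  have x0 : 0 < x by apply: lt_le_trans ax.
  have [dG GE] := continuous_FTC1_closed xu (@continuous_integrable (x + 1) g cg) x0 (cg x).
  by apply: DeriveDef; [exact: dG|rewrite -derive1E GE].
apply: contraNT => /negP out; have [xa|ax] := ltP x a; first by rewrite Ga.
have [bx|xb] := ltP b x; last by case: out; rewrite ax.
have mkb y : b < y -> G y = (\int[mu]_(t in `[0%R, b]) g t)%R.
  move=> yb; rewrite /G Rintegral_mkcond [RHS]Rintegral_mkcond.
  apply: eq_Rintegral => t _; rewrite !patchE.
  case: ifPn => [/set_mem|/negP tn]; rewrite /= ?in_itv /=.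
    move=> /andP[t0 ty]; case: ifPn => // /negP tn.
    apply: (supported_eq0 sup); right; rewrite ltNge; apply/negP => tb.
    by apply: tn; rewrite inE /= in_itv /= t0 tb.
  case: ifPn => // /set_mem; rewrite /= in_itv /= => /andP[t0 tb]; case: tn.
  by rewrite inE /= in_itv /= t0 (le_trans tb (ltW yb)).
by rewrite mkb // -(mkb l) // /G ig.
Unshelve. all: by end_near. Qed.

Lemma test_functionE l phi : test_function l phi <->
  smooth phi /\ exists a b, [/\ 0 < a, b < l & supported phi a b].
Proof. by split=> [[]|[]]. Qed.

Lemma test_function_derive1 l phi : test_function l phi ->
  test_function l (derive1 phi).
Proof.
move=> /test_functionE[sm [a [b [a0 bl sup]]]]; apply/test_functionE.
split; first exact: smooth_derive1.
exists a, b; split => //; apply: supported_derive sup => x.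
exact: smooth_is_derive.
Qed.

Lemma L2_measurable l u : in_L2 l u -> measurable_fun (`]0, l[%classic : set R) u.
Proof.
rewrite /in_L2 inE => /andP[+ _]; rewrite inE /= => mu_u.
exact: (measurable_restrictT u (measurable_itv `]0, l[)).2 mu_u.
Qed.

(** Testing the first weak derivative against [phi'] and the second against [phi] gives [\int u
    phi'' = - \int v phi' = \int w phi], and [w = - k ^ 2 u] almost everywhere. *)
Lemma weak_solution_test l k u w phi : H2_second_derivative l u w ->
  {ae mu, forall t, 0 < t < l -> k ^+ 2 * u t = - w t} ->
  test_function l phi -> {within `[0, l], continuous u} ->
  (\int[mu]_(x in `[0, l]) (u x * (derive1 (derive1 phi) x + k ^+ 2 * phi x)))%R = 0.
Proof.
move=> [Lu Lw [v [_ uv vw]]] aew tphi cu.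
have := tphi => /test_functionE[sm _].
have cphi : continuous phi by exact: smooth_continuous.
have cphi2 : continuous (derive1 (derive1 phi)).
  by apply: smooth_continuous; do 2!apply: smooth_derive1.
have cuphi : {within `[0, l], continuous (fun x => u x * phi x)}.
  by move=> x; apply: cvgM; [exact: cu|exact: (continuous_subspaceT cphi)].
have cuphi2 : {within `[0, l], continuous (fun x => u x * derive1 (derive1 phi) x)}.
  by move=> x; apply: cvgM; [exact: cu|exact: (continuous_subspaceT cphi2)].
have ckuphi : {within `[0, l], continuous (fun x => k ^+ 2 * (u x * phi x))}.
  by move=> x; apply: cvgM; [exact: cvg_cst|exact: cuphi].
have -> : (fun x => u x * (derive1 (derive1 phi) x + k ^+ 2 * phi x)) =
    (fun x => u x * derive1 (derive1 phi) x + k ^+ 2 * (u x * phi x)).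
  by apply/funext => x; ring.
rewrite RintegralD //; [|exact: segment_integrable|exact: segment_integrable].
rewrite -!Rintegral_oo_cc //.
rewrite (uv _ (test_function_derive1 tphi)) (vw _ tphi) opprK.
suff -> : (\int[mu]_(x in `]0, l[) (w x * phi x))%R =
    (\int[mu]_(x in `]0, l[) (- (k ^+ 2 * (u x * phi x))))%R.
  have int_oo h : {within `[0, l], continuous h} -> mu.-integrable `]0, l[ (EFin \o h).
    move=> /segment_integrable int_cc.
    by apply: integrableS int_cc => //; exact: subset_itv_oo_cc.
  rewrite -RintegralD //; [|apply: int_oo|exact: int_oo].
    by under eq_Rintegral do rewrite addNr; rewrite Rintegral_cst // mul0r.
  by move=> x; apply: cvgN; exact: ckuphi.
have mphi : measurable_fun (`]0, l[%classic : set R) phi.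
  apply: measurable_funS (measurable_realfun.continuous_measurable_fun cphi) => //.
have mw := L2_measurable Lw; have mu_u := L2_measurable Lu.
congr fine; apply: ae_eq_integral => //.
- by apply/measurable_realfun.measurable_EFinP; apply: measurable_realfun.measurable_funM.
- apply/measurable_realfun.measurable_EFinP; apply: measurableT_comp => //.
  by apply: measurable_realfun.measurable_funM => //; apply: measurable_realfun.measurable_funM.
have aeF := ae_filter_ringOfSetsType mu.
apply: filterS aew => x /= h; rewrite in_itv /= => /h wE.
by congr (_%:E); rewrite mulrA wE; ring.
Qed.

End WeakSolutions.

(** * Regularity of eigenfunctions *)

Section EdgeRegularity.
Context {R : realType}.
Local Notation mu := (@lebesgue_measure R).
Implicit Types (g u v w phi psi : R -> R) (a b l k x : R).

(** Variation of constants; orthogonality to cosine and sine makes the two primitives supported in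
    [[a, b]]. *)
Lemma oscillator_solution l k psi a b : k != 0 -> 0 < a -> b < l ->
  smooth psi -> supported psi a b ->
  (\int[mu]_(x in `[0, l]) (wave k 1 0 x * psi x))%R = 0 ->
  (\int[mu]_(x in `[0, l]) (wave k 0 1 x * psi x))%R = 0 ->
  exists2 phi, test_function l phi &
    forall x, derive1 (derive1 phi) x + k ^+ 2 * phi x = psi x.
Proof.
move=> k0 a0 bl spsi sup ic is_.
have prim (c d : R) : (\int[mu]_(x in `[0, l]) (wave k c d x * psi x))%R = 0 ->
    exists G, [/\ smooth G, supported G a b &
      forall x, is_derive x 1 G (wave k c d x * psi x)].
  have sm : smooth (fun x => wave k c d x * psi x).
    exact: smoothM (@smooth_wave R k c d) spsi.
  move=> /(compact_primitive (smooth_continuous sm) a0 bl)[x nz|G [dG supG]].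
    by apply: sup; apply: contraNneq nz => ->; rewrite mulr0.
  by exists G; exact: And3 (smooth_primitive dG sm) supG dG.
have [G1 [sG1 sup1 dG1]] := prim _ _ ic; have [G2 [sG2 sup2 dG2]] := prim _ _ is_.
pose phi x := wave k 0 k^-1 x * G1 x + wave k (- k^-1) 0 x * G2 x.
pose phi1 x := wave k 1 0 x * G1 x + wave k 0 1 x * G2 x.
have dphi x : is_derive x 1 phi (phi1 x).
  have := dG1 x; have := dG2 x; have := wave_is_derive k 0 k^-1 x.
  have := wave_is_derive k (- k^-1) 0 x => ? ? ? ?.
  apply: is_derive_eq; rewrite /phi1 /wave /GRing.scale /=; field.
  by rewrite k0.
have dphi1 x : is_derive x 1 phi1 (psi x - k ^+ 2 * phi x).
  have := dG1 x; have := dG2 x; have := wave_is_derive k 1 0 x.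
  have := wave_is_derive k 0 1 x => ? ? ? ?.
  apply: is_derive_eq.
  rewrite -[in RHS](mulr1 (psi x)) -[in RHS](cos2Dsin2 (k * x)).
  by rewrite /phi /wave /GRing.scale /=; field; rewrite k0.
have phi'E : derive1 phi = phi1.
  by apply/funext => x; rewrite derive1E; have [_] := dphi x.
exists phi; last first.
  by move=> x; rewrite phi'E derive1E; have [_ ->] := dphi1 x; rewrite subrK.
apply/test_functionE; split.
  exact: smoothD (smoothM (@smooth_wave R k 0 k^-1) sG1)
    (smoothM (@smooth_wave R k (- k^-1) 0) sG2).
exists a, b; split => // x; apply: contraNT => /negP out.
have z G : supported G a b -> G x = 0 by move=> s; apply: contrapT => /eqP /s.
by rewrite /phi (z _ sup1) (z _ sup2) !mulr0 addr0.
Qed.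

(** For a narrow bump around [t], the product of [g t], [g] and the bump is nonnegative with
    integral 0, so its primitive vanishes on [[0, l]]; if [g t] were nonzero, that primitive would
    have a positive derivative at [t]. *)
Lemma vanishing_continuous l g : {within `[0, l], continuous g} ->
  (forall a b, 0 < a -> b < l ->
    (\int[mu]_(x in `[0, l]) (g x * bump a b x))%R = 0) ->
  forall x, 0 < x < l -> g x = 0.
Proof.
move=> cg orth t /andP[t0 tl]; apply: contrapT => /eqP gt0.
have l0 : 0 < l := lt_trans t0 tl.
have [cgo _ _] := (continuous_within_itvP g l0).1 cg.
have cgt : {for t, continuous g} by apply: cgo; rewrite in_itv /= t0 tl.
have pos : 0 < g t * g t by rewrite -expr2 lt_neqAle sqr_ge0 eq_sym sqrf_eq0 gt0.
have : \forall x \near t, 0 < g x * g t.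
  have cgg : g x * g t @[x --> t] --> g t * g t.
    by apply: cvgM; [exact: cgt|exact: cvg_cst].
  exact: (cvgr_gt _ cgg).
move=> /nbhs_ballP[e /= e0 eP].
(* Narrow enough to stay where [g] has the sign of [g t], and inside the interval. *)
pose s := Num.min (e / 2) (Num.min (t / 2) ((l - t) / 2)).
have s0 : 0 < s by rewrite !lt_min !divr_gt0 // subr_gt0.
have half x : 0 < x -> x / 2 < x by move=> x0; lra.
have [se st sl] : [/\ s < e, s < t & s < l - t].
  by split; rewrite !gt_min half ?orbT ?subr_gt0.
pose B := bump (t - s) (t + s).
have cB : continuous B by exact/smooth_continuous/smooth_bump.
pose h x := g t * (g x * B x).
have h0 x : 0 <= h x.
  have [Bx0|Bx] := eqVneq (B x) 0; first by rewrite /h Bx0 !mulr0.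
  have /andP[x1 x2] := bump_support Bx.
  rewrite /h mulrA mulr_ge0 ?bump_ge0 // mulrC ltW //; apply: eP.
  by rewrite /ball /= ltr_norml; apply/andP; split; lra.
have ch : {within `[0, l], continuous h}.
  move=> x; apply: cvgM; first exact: cvg_cst.
  by apply: cvgM; [exact: cg|exact: (continuous_subspaceT cB)].
have int_h := segment_integrable ch.
have ih : (\int[mu]_(x in `[0%R, l]) (h x)%:E = 0)%E.
  rewrite -[LHS]fineK; last exact: integrable_fin_num.
  rewrite -/(Rintegral _ _ _) RintegralZl //; last first.
    apply: segment_integrable => x.
    by apply: cvgM; [exact: cg|exact: (continuous_subspaceT cB)].
  by rewrite orth ?mulr0 //; lra.
pose H x := (\int[mu]_(y in `[0%R, x]) h y)%R.
have H0 x : x <= l -> H x = 0.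
  move=> xl; rewrite /H /Rintegral.
  suff -> : (\int[mu]_(y in `[0%R, x]) (h y)%:E = 0)%E by [].
  apply/eqP; rewrite eq_le; apply/andP; split; last first.
    by apply: integral_ge0 => y _; rewrite lee_fin.
  rewrite -ih; apply: ge0_subset_integral => //.
  - by have /integrableP[] := int_h.
  - by move=> y _; rewrite /= lee_fin.
  - by move=> y /=; rewrite !in_itv /= => /andP[-> yx]; exact: le_trans xl.
have cht : {for t, continuous h}.
  apply: cvgM; first exact: cvg_cst.
  by apply: cvgM; [exact: cgt|exact: cB].
have [_ Ht] := continuous_FTC1_closed tl int_h t0 cht.
have : 0 < h t.
  by rewrite /h mulrA mulr_gt0 // bump_gt0 // gtrBl ltrDl s0.
rewrite -Ht derive1E (@near_eq_derive _ _ _ _ (fun=> 0)).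
  by rewrite derive_cst ltxx.
by near=> y; apply: H0; rewrite ltW //; near: y; exact: lt_nbhsl.
Unshelve. all: by end_near. Qed.

Lemma vanishing_wave l k a b : 0 < l -> 0 < k ->
  (forall x, 0 < x < l -> wave k a b x = 0) -> a = 0 /\ b = 0.
Proof.
(* The values at [s] and [2 * s] determine both coefficients: the determinant is [sin (k * s)],
   which is nonzero. *)
move=> l0 k0 w0; pose s := Num.min (l / 3) (pi / k / 2).
have pk : 0 < pi / k :> R by rewrite divr_gt0 // pi_gt0.
have s0 : 0 < s by rewrite lt_min !divr_gt0 ?pi_gt0.
have sl : 2 * s < l.
  have : s <= l / 3 by rewrite ge_min lexx.
  by lra.
have spi : 0 < k * s < pi.
  rewrite mulr_gt0 //= mulrC -ltr_pdivlMr // gt_min orbC.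
  by rewrite ltr_pdivrMr // ltr_pMr // ltr1n.
have sin0 := gt_eqF (sin_gt0_pi spi).
have ws : wave k a b s = 0 by apply: w0; rewrite s0; lra.
have w2s : wave k a b (2 * s) = 0 by apply: w0; rewrite sl andbT; lra.
have kE : k * s = k * (2 * s) - k * s by ring.
split; apply/eqP.
- have : a * sin (k * s) = wave k a b s * sin (k * (2 * s)) - wave k a b (2 * s) * sin (k * s).
    by rewrite {1}kE sinB /wave; ring.
  by rewrite ws w2s !mul0r subrr => /eqP; rewrite mulf_eq0 sin0 orbF.
- have : b * sin (k * s) = wave k a b (2 * s) * cos (k * s) - wave k a b s * cos (k * (2 * s)).
    by rewrite {1}kE sinB /wave; ring.
  by rewrite ws w2s !mul0r subrr => /eqP; rewrite mulf_eq0 sin0 orbF.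
Qed.

Lemma Rintegral_lin l (c1 c2 : R) g1 g2 : {within `[0, l], continuous g1} ->
  {within `[0, l], continuous g2} ->
  (\int[mu]_(x in `[0, l]) (c1 * g1 x + c2 * g2 x) =
   c1 * \int[mu]_(x in `[0, l]) g1 x + c2 * \int[mu]_(x in `[0, l]) g2 x)%R.
Proof.
move=> cg1 cg2.
have cZ (c : R) g : {within `[0, l], continuous g} ->
    {within `[0, l], continuous (fun x => c * g x)}.
  by move=> cg x; apply: cvgM; [exact: cvg_cst|exact: cg].
rewrite RintegralD //; try by apply: segment_integrable; exact: cZ.
by rewrite !RintegralZl //; exact: segment_integrable.
Qed.

(* The bumps detect the two coordinates of a wave, so the functional
   [psi |-> \int u psi] factors through the integrals against cosine and sine. *)
Lemma weak_solution_wave l k u : 0 < l -> 0 < k ->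
  {within `[0, l], continuous u} ->
  (forall phi, test_function l phi ->
    (\int[mu]_(x in `[0, l]) (u x * (derive1 (derive1 phi) x + k ^+ 2 * phi x)))%R = 0) ->
  exists a b, forall x, 0 < x < l -> u x = wave k a b x.
Proof.
move=> l0 k0 cu weak.
have cramer (p1 q1 p2 q2 u1 u2 y p q : R) : p1 * q2 - q1 * p2 != 0 ->
    (p1 * q2 - q1 * p2) * y = (p * q2 - q * p2) * u1 + (p1 * q - q1 * p) * u2 ->
    1 * y + -1 * ((q2 * u1 - q1 * u2) / (p1 * q2 - q1 * p2) * p +
      (p1 * u2 - p2 * u1) / (p1 * q2 - q1 * p2) * q) = 0.
  move=> d0 yE; apply: (mulfI d0); rewrite mulr0 mulrDr mul1r yE; field.
  exact: d0.
pose I g psi := (\int[mu]_(x in `[0%R, l]) (g x * psi x))%R.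
have cM g psi : {within `[0, l], continuous g} -> smooth psi ->
    {within `[0, l], continuous (fun x => g x * psi x)}.
  move=> cg spsi x; apply: cvgM; first exact: cg.
  exact: (continuous_subspaceT (smooth_continuous spsi)).
have cw c d : {within `[0, l], continuous (wave k c d)}.
  exact: (continuous_subspaceT (@wave_continuous R k c d)).
have Ilin c1 c2 g1 g2 psi : {within `[0, l], continuous g1} ->
    {within `[0, l], continuous g2} -> smooth psi ->
    I (fun x => c1 * g1 x + c2 * g2 x) psi = c1 * I g1 psi + c2 * I g2 psi.
  move=> cg1 cg2 spsi; rewrite /I -Rintegral_lin; [|exact: cM|exact: cM].
  by apply: eq_Rintegral => x _; ring.
have Irlin c1 c2 g psi1 psi2 : {within `[0, l], continuous g} ->
    smooth psi1 -> smooth psi2 ->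
    I g (fun x => c1 * psi1 x + c2 * psi2 x) = c1 * I g psi1 + c2 * I g psi2.
  move=> cg s1 s2; rewrite /I -Rintegral_lin; [|exact: cM|exact: cM].
  by apply: eq_Rintegral => x _; ring.
have waveI c d psi : smooth psi ->
    I (wave k c d) psi = c * I (wave k 1 0) psi + d * I (wave k 0 1) psi.
  move=> spsi; rewrite -Ilin //; congr (I _ psi).
  by apply/funext => x; rewrite /wave; ring.
pose P a b := I (wave k 1 0) (bump a b); pose Q a b := I (wave k 0 1) (bump a b).
have waveB c d : (forall a b, 0 < a -> b < l -> c * P a b + d * Q a b = 0) ->
    c = 0 /\ d = 0.
  move=> z; apply: (@vanishing_wave l k) => //; apply: vanishing_continuous => //.
  by move=> a b a0 bl; rewrite -[LHS]/(I _ _) waveI ?z //; exact: smooth_bump.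
have [a1 [b1 [a2 [b2 [[a10 b1l] [a20 b2l] D0]]]]] : exists a1 b1 a2 b2,
    [/\ 0 < a1 /\ b1 < l, 0 < a2 /\ b2 < l &
        P a1 b1 * Q a2 b2 - Q a1 b1 * P a2 b2 != 0].
  (* If every determinant vanished, the wave with coordinates [- Q a b] and [P a b] would be
     orthogonal to all bumps, hence zero; then every [P a b] is 0, and the cosine itself would
     vanish. *)
  apply: contrapT => none.
  suff : (1 : R) = 0 /\ (0 : R) = 0 by case=> /eqP; rewrite oner_eq0.
  apply: (waveB) => a b a0 bl; rewrite mul1r mul0r addr0.
  suff [] : - Q a b = 0 /\ P a b = 0 by [].
  apply: (waveB) => c d c0 dl; rewrite mulNr addrC; apply: contrapT => /eqP nz.
  by apply: none; exists a, b, c, d.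
set P1 := P a1 b1 in D0; set Q1 := Q a1 b1 in D0.
set P2 := P a2 b2 in D0; set Q2 := Q a2 b2 in D0.
set D := P1 * Q2 - Q1 * P2 in D0.
pose U a b := I u (bump a b).
have UE a b : 0 < a -> b < l -> D * U a b =
    (P a b * Q2 - Q a b * P2) * U a1 b1 + (P1 * Q a b - Q1 * P a b) * U a2 b2.
  (* By Cramer's rule [chi] is orthogonal to cosine and sine, so [oscillator_solution] writes it as
     [phi'' + k ^ 2 phi] and [weak] gives [I u chi = 0]. *)
  move=> a0 bl; pose c1 := P a b * Q2 - Q a b * P2; pose c2 := P1 * Q a b - Q1 * P a b.
  pose chi x := D * bump a b x + -1 * (c1 * bump a1 b1 x + c2 * bump a2 b2 x).
  have sZ c a' b' : smooth (fun x => c * bump a' b' x).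
    exact: smoothM (@smooth_cst R c) (@smooth_bump R a' b').
  have s12 : smooth (fun x => c1 * bump a1 b1 x + c2 * bump a2 b2 x).
    exact: smoothD (sZ c1 a1 b1) (sZ c2 a2 b2).
  have schi : smooth chi.
    exact: smoothD (sZ D a b) (smoothM (@smooth_cst R (-1)) s12).
  have Ichi g : {within `[0, l], continuous g} -> I g chi =
      D * I g (bump a b) - (c1 * I g (bump a1 b1) + c2 * I g (bump a2 b2)).
    move=> cg; rewrite (Irlin D (-1) g _ _ cg (@smooth_bump R a b) s12) mulN1r.
    by rewrite (Irlin c1 c2 g _ _ cg (@smooth_bump R a1 b1) (@smooth_bump R a2 b2)).
  pose am := Num.min a (Num.min a1 a2); pose bM := Num.max b (Num.max b1 b2).
  have sup : supported chi am bM.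
    move=> x; apply: contraNT => out.
    have z a' b' : am <= a' -> b' <= bM -> bump a' b' x = 0.
      move=> ha hb; apply: contrapT => /eqP /bump_support /andP[ax xb].
      by case/negP: out; rewrite (le_trans ha) // (le_trans xb).
    have [ha ha1 ha2] : [/\ am <= a, am <= a1 & am <= a2].
      by split; rewrite /am !ge_min lexx ?orbT.
    have [hb hb1 hb2] : [/\ b <= bM, b1 <= bM & b2 <= bM].
      by split; rewrite /bM !le_max lexx ?orbT.
    by apply/eqP; rewrite /chi (z a b) // (z a1 b1) // (z a2 b2) //; ring.
  have am0 : 0 < am by rewrite !lt_min a0 a10 a20.
  have bMl : bM < l by rewrite !gt_max bl b1l b2l.
  have [||phi tphi phiE] := oscillator_solution (lt0r_neq0 k0) am0 bMl schi sup.
  - rewrite -[LHS]/(I _ chi) Ichi // -/(P a b) -/(P a1 b1) -/(P a2 b2) -/P1 -/P2.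
    by rewrite /c1 /c2 /D; ring.
  - rewrite -[LHS]/(I _ chi) Ichi // -/(Q a b) -/(Q a1 b1) -/(Q a2 b2) -/Q1 -/Q2.
    by rewrite /c1 /c2 /D; ring.
  have : I u chi = 0.
    rewrite -(weak _ tphi); apply: eq_Rintegral => x _.
    by rewrite phiE.
  by rewrite Ichi // => /eqP; rewrite subr_eq0 => /eqP.
(* Coordinates of the wave that has the same integrals as [u] against the two chosen bumps. *)
pose al := (Q2 * U a1 b1 - Q1 * U a2 b2) / D.
pose be := (P1 * U a2 b2 - P2 * U a1 b1) / D.
exists al, be => x xl; apply/eqP; rewrite -subr_eq0; apply/eqP.
apply: (@vanishing_continuous l (fun x => u x - wave k al be x)) => //.
  by move=> y; apply: cvgB; [exact: cu|exact: cw].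
move=> a b a0 bl; have sb := @smooth_bump R a b.
have -> : (\int[mu]_(x in `[0, l]) ((u x - wave k al be x) * bump a b x))%R =
    I (fun x => 1 * u x + -1 * wave k al be x) (bump a b).
  by apply: eq_Rintegral => y _; ring.
rewrite Ilin // waveI // -/(U a b) -/(P a b) -/(Q a b).
exact: cramer D0 (UE _ _ a0 bl).
Qed.

Lemma wave_segment l k a b u : 0 < l -> {within `[0, l], continuous u} ->
  (forall x, 0 < x < l -> u x = wave k a b x) ->
  forall x, 0 <= x <= l -> u x = wave k a b x.
Proof.
move=> l0 cu uE x /andP[x0 xl].
have [_ u0 ul] := (continuous_within_itvP u l0).1 cu.
have cw := @wave_continuous R k a b.
have [<-|xn0] := eqVneq 0 x.
  apply: (cvg_unique _ u0) => //.
  have : wave k a b y @[y --> 0^'+] --> wave k a b 0.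
    by apply: cvg_at_right_filter; exact: cw.
  apply: cvg_trans; apply: near_eq_cvg; near=> y; rewrite -uE //.
  by apply/andP; split; near: y; [exact: nbhs_right_gt|exact: nbhs_right_lt].
have [->|xnl] := eqVneq x l.
  apply: (cvg_unique _ ul) => //.
  have : wave k a b y @[y --> l^'-] --> wave k a b l.
    by apply: cvg_at_left_filter; exact: cw.
  apply: cvg_trans; apply: near_eq_cvg; near=> y; rewrite -uE //.
  by apply/andP; split; near: y; [exact: nbhs_left_gt|exact: nbhs_left_lt].
by apply: uE; rewrite !lt_neqAle xn0 x0 xnl.
Unshelve. all: by end_near. Qed.

End EdgeRegularity.

Lemma eigenfunction_wave {R : realType} (G : metric_graph R) (k : R)
    (f : graph_point G -> R) (e : edge G) : 0 < k -> eigenfunction (k ^+ 2) f ->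
  exists b, forall t, 0 <= t <= len e ->
    on_edge f e t = wave k (f (vertex_point (src e))) b t.
Proof.
move=> k0 [_ [[cf _ _] /(_ e)[w H2w aew]]].
have [phi tphi|a [b fE]] := weak_solution_wave (len_gt0 e) k0 (cf e).
  exact: weak_solution_test H2w aew tphi (cf e).
have fE' := wave_segment (len_gt0 e) (cf e) fE.
exists b; have -> // : f (vertex_point (src e)) = a.
have := fE' 0; rewrite lexx ltW ?len_gt0 // => /(_ isT).
by rewrite /on_edge edge_point_src /wave mulr0 cos0 sin0 mulr1 mulr0 addr0.
Qed.

(** * Extrema of eigenfunctions *)

Section Extrema.
Context {R : realType} {G : metric_graph R}.
Implicit Types (d : dart G) (v : vertex G).

(* Half-angle formulas turn the hypothesis into
   [sigma * b * cos y <= sigma * a * sin y] for small [y > 0]. *)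
Lemma wave_slope (sigma k a b delta : R) : 0 < k -> 0 < delta ->
  (forall s, 0 < s < delta -> sigma * wave k a b s <= sigma * a) ->
  sigma * b <= 0.
Proof.
move=> k0 delta0 le; rewrite leNgt; apply/negP => sb.
pose h y := sigma * b * cos y - sigma * a * sin y.
have ch : h y @[y --> 0^'+] --> h 0.
  apply: cvg_at_right_filter; apply: cvgB; apply: cvgM; try exact: cvg_cst.
    exact: continuous_cos.
  exact: continuous_sin.
have h0 : 0 < h 0 by rewrite /h cos0 sin0 mulr1 mulr0 subr0.
have pi0 := @pi_gt0 R.
have : \forall y \near (0 : R)^'+, False; last by move/filter_ex => [].
near=> y.
have y0 : 0 < y by near: y; exact: nbhs_right_gt.
have hy : 0 < h y by near: y; exact: (cvgr_gt _ ch).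
have ypi : y < pi by near: y; exact: nbhs_right_lt.
have yd : y < k * delta / 2.
  by near: y; apply: nbhs_right_lt; rewrite divr_gt0 // mulr_gt0.
have siny : 0 < sin y by rewrite sin_gt0_pi // y0 ypi.
have : 0 < 2 * y / k < delta.
  rewrite divr_gt0 ?mulr_gt0 //= ltr_pdivrMr // [delta * k]mulrC.
  by move: yd; lra.
move=> /le; rewrite /wave mulrCA divff ?gt_eqF // mulr1.
have -> : 2 * y = y + y by ring.
rewrite cosD sinD; have c2 := cos2Dsin2 y.
have : 0 < 2 * sin y * h y by rewrite !mulr_gt0.
have -> : 2 * sin y * h y = sigma * (a * (cos y * cos y - sin y * sin y) +
    b * (sin y * cos y + cos y * sin y)) -
    sigma * a * (cos y ^+ 2 + sin y ^+ 2) by rewrite /h; ring.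
by rewrite c2 mulr1 => ? ?; lra.
Unshelve. all: by end_near. Qed.

Context (acyclic : forall c : seq (dart G), ~~ is_cycle c).
Context (connected : connected_graph G).
Context (f : graph_point G -> R) (K : R) (beta : dart G -> R).
Context (K_gt0 : 0 < K).
Local Notation F := (fun v => f (vertex_point v)).
Context (modeF : mode K F beta) (fE : wave_edges K f beta).
Context (no_low_mode : ~ @low_mode R G K).
Context (f_neq0 : exists x, f x != 0).
(** The factor [sigma], later 1 or -1, treats maxima and minima at once. *)
Context (sigma : R) (sigma_neq0 : sigma != 0).
Context (x : graph_point G) (extremal : forall y, sigma * f y <= sigma * f x).

Lemma dart_value d s : 0 <= s <= len d.1 ->
  exists y, f y = wave K (F (dart_tail d)) (beta d) s.
Proof.
case: d => e [] s_in; first by exists (edge_point e s); exact: fE.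
exists (edge_point e (len e - s)).
have s_in' : 0 <= len e - s <= len e.
  by move: s_in => /= /andP[s0 sl]; apply/andP; split; lra.
rewrite -[LHS]/(on_edge f e _) (fE s_in') /wave.
have [<- _] := mode_reverse (e, true) (len e - s) modeF.
by rewrite /= subKr.
Qed.

(** By [wave_slope] the slopes leaving an extremal vertex share a weak sign, and the vertex
    condition makes them sum to 0. *)
Lemma extremal_vertex v : sigma * F v = sigma * f x ->
  forall d, dart_tail d = v -> beta d = 0.
Proof.
move=> ex; have [_ _ sm] := modeF.
have le0 d : dart_tail d == v -> sigma * beta d <= 0.
  move=> /eqP dv; apply: (wave_slope K_gt0 (len_gt0 d.1) (a := F v)) => s /andP[s0 sl].
  have [|y yE] := @dart_value d s; first by rewrite !ltW.
  by rewrite -dv -yE dv ex; exact: extremal.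
have : \sum_(d | dart_tail d == v) - (sigma * beta d) = 0.
  by rewrite sumrN -mulr_sumr sm mulr0 oppr0.
move=> /eqP; rewrite psumr_eq0 => [/allP all0 d dv|d dv]; last by rewrite oppr_ge0 le0.
have := all0 d (mem_index_enum d); rewrite dv eqxx /= oppr_eq0 mulf_eq0.
by rewrite (negbTE sigma_neq0) => /eqP.
Qed.

(** If the extremal value is 0, a vertex with value 0 is extremal, so all slopes there vanish and
    the zero spreads along its edges; by connectedness [f] would vanish identically. *)
Lemma extremal_value_neq0 v : f x = 0 -> F v != 0.
Proof.
move=> fx0; apply/negP => Fv0; case: f_neq0 => y /eqP; apply.
have beta0 w : F w == 0 -> forall d, dart_tail d = w -> beta d = 0.
  by move=> /eqP Fw; apply: extremal_vertex; rewrite Fw fx0.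
have step : fingraph.closed (@Defs.adjacent R G) [pred w | F w == 0].
  have one d : F (dart_tail d) == 0 -> F (dart_head d) == 0.
    move=> Fd; have [hd _ _] := modeF; rewrite hd (eqP Fd) (beta0 _ Fd d) //.
    by rewrite !mul0r addr0.
  move=> a b /existsP[e /orP[] /andP[/eqP <- /eqP <-]]; rewrite !inE;
    apply/idP/idP; by [exact: (one (e, true))|exact: (one (e, false))].
have F0 w : F w == 0.
  by have := closed_connect step (connected v w); rewrite !inE Fv0 => <-.
case: y => [w|[e [t t_in]]]; first exact/eqP/F0.
have := fE (e := e) (t := t); have /andP[t0 tl] := t_in.
rewrite /on_edge (edge_point_inner t_in) => ->; last by rewrite !ltW.
rewrite (eqP (F0 _)) /wave mul0r add0r.
by rewrite (beta0 _ (F0 (src e)) (e, true)) // mul0r.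
Qed.

Lemma extremal_not_inner : exists v, x = vertex_point v.
Proof.
case xE: x => [v|[e [t t_in]]]; first by exists v.
exfalso.
have [A [p [angleE angle0 thr]]] := thresholds_exist acyclic.
have /andP[t0 tl] := t_in.
pose a := f (vertex_point (src e)); pose b := beta (e, true).
pose g := wave K a b t.
pose g' := b * cos (K * t) - a * sin (K * t).
have fx : f x = g.
  rewrite xE -(edge_point_inner t_in) -[LHS]/(on_edge f e t).
  by apply: fE; rewrite !ltW.
have fg s : 0 <= s <= len e -> sigma * wave K a b s <= sigma * g.
  by move=> s_in; rewrite -(fE s_in) -fx; exact: extremal.
(* The wave is recentred at [t] and read in both directions, so that [wave_slope] bounds its slope
   from both sides. *)
have le1 : sigma * g' <= 0.
  apply: (wave_slope K_gt0 (_ : 0 < len e - t) (a := g)); first by rewrite subr_gt0.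
  move=> s /andP[s0 sl].
  have -> : wave K g g' s = wave K a b (t + s).
    by rewrite /wave mulrDr cosD sinD /g /g' /wave; ring.
  by apply: fg; apply/andP; split; lra.
have le2 : sigma * - g' <= 0.
  apply: (wave_slope K_gt0 t0 (a := g)) => s /andP[s0 sl].
  have -> : wave K g (- g') s = wave K a b (t - s).
    by rewrite /wave mulrBr cosB sinB /g /g' /wave; ring.
  by apply: fg; apply/andP; split; lra.
have g'0 : g' = 0.
  have : sigma * g' == 0 by rewrite eq_le le1 -oppr_le0 -mulrN.
  by rewrite mulf_eq0 (negbTE sigma_neq0) => /eqP.
have [g0|gn0] := eqVneq g 0; last first.
  apply: no_low_mode.
  have der : b * cos (K * t) = a * sin (K * t) by apply: subr0_eq.
  exact: (@edge_low_mode _ _ acyclic _ _ angleE angle0 thr K _ beta (e, true) t K_gt0 modeF t_in gn0 der).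
(* Zero value and zero slope at [t] make the wave vanish along the edge, in particular at its
   source. *)
have /negP := @extremal_value_neq0 (src e) (etrans fx g0); apply.
have -> : f (vertex_point (src e)) = g * cos (K * t) - g' * sin (K * t).
  rewrite -[LHS]mulr1 -(cos2Dsin2 (K * t)) /g' /g /wave -/a; ring.
by rewrite g0 g'0 !mul0r subrr.
Qed.

Lemma extremal_degree v : x = vertex_point v -> (0 < #|edge G|)%N -> degree v = 1%N.
Proof.
move=> xv /card_gt0P[e0 _].
have [A [p [angleE angle0 thr]]] := thresholds_exist acyclic.
have beta0 d : dart_tail d = v -> beta d = 0.
  by apply: extremal_vertex; rewrite xv.
have Fv : F v != 0.
  by have [/(@extremal_value_neq0 v)|] := eqVneq (f x) 0; rewrite ?xv.
(* For an edge [e] incident to [v], this is a dart over [e] that leaves [v]. *)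
pose toward e : dart G := (e, src e == v).
have toward_tail e : (src e == v) || (tgt e == v) -> dart_tail (toward e) = v.
  by rewrite /toward /dart_tail /=; case: eqP => //= _ /eqP.
apply/eqP; rewrite eqn_leq; apply/andP; split.
  apply/card_le1_eqP => e1 e2; rewrite !inE => i1 i2.
  apply: contrapT => e12; apply: no_low_mode.
  have t1 := toward_tail _ i1; have t2 := toward_tail _ i2.
  apply: (@vertex_low_mode _ _ acyclic _ _ angleE angle0 thr K _ beta
    (toward e1) (toward e2) K_gt0 modeF (etrans t1 (esym t2)) _ _ (beta0 _ t1) (beta0 _ t2)).
    by apply/eqP => -[e _]; exact: e12.
  by rewrite t1.
(* The degree is positive: either [e0] starts at [v], or a path from [v] to the source of [e0]
   begins with an edge at [v]. *)
have [e0v|e0v] := eqVneq (src e0) v.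
  by apply/card_gt0P; exists e0; rewrite inE e0v eqxx.
have /connectP[[|w q] /=] := connected v (src e0).
  by move=> _ e; rewrite e eqxx in e0v.
move=> /andP[/existsP[e vw] _] _; apply/card_gt0P; exists e; rewrite inE.
by case/orP: vw => /andP[? ?]; apply/orP; [left|right].
Qed.

End Extrema.

Unset Implicit Arguments.

Theorem theorem2p1 (R : realType) (G : metric_graph R)
  (has_edge : (0 < #|edge G|)%N) (tree : is_tree G)
  (mu2 : R) (mu2_first : first_positive_eigenvalue G mu2)
  (f : graph_point G -> R) (f_eigen : eigenfunction mu2 f)
  (x : graph_point G)
  (x_extremum : (forall y, f y <= f x) \/ (forall y, f x <= f y)) :
  exists v : vertex G, x = vertex_point v /\ degree v = 1%N.
Proof.
have [connected acyclic] := tree; have [mu2_gt0 _ mu2_min] := mu2_first.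
pose K := Num.sqrt mu2.
have K0 : 0 < K by rewrite sqrtr_gt0.
have KE : K ^+ 2 = mu2 by rewrite sqr_sqrtr // ltW.
(* A mode of frequency [k < K] would yield the positive eigenvalue [k ^ 2] below [mu2]. *)
have no_low : ~ @low_mode R G K.
  move=> [k [k0 kK /(mode_eigenvalue k0)]].
  move=> /(mu2_min _ (exprn_gt0 _ k0)); rewrite -KE leNgt => /negP; apply.
  by rewrite ltr_pXn2r // ?nnegrE ltW.
rewrite -KE in f_eigen; have [f_neq0 [[_ _ kir] _]] := f_eigen.
have [beta [modeF fE]] :=
  eigenfunction_mode K0 kir (fun e => eigenfunction_wave e K0 f_eigen).
have [sigma sigma_neq0 ex] : exists2 sigma : R, sigma != 0 &
    forall y, sigma * f y <= sigma * f x.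
  case: x_extremum => ex; [exists 1|exists (-1)]; rewrite ?oppr_eq0 ?oner_eq0 // => y.
    by rewrite !mul1r.
  by rewrite !mulN1r lerN2.
have [v xv] := extremal_not_inner acyclic connected K0 modeF fE no_low f_neq0 sigma_neq0 ex.
exists v; split => //.
exact: (extremal_degree acyclic connected K0 modeF fE no_low f_neq0 sigma_neq0 ex xv has_edge).
Qed.
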